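(* Let $\mathcal J\subset\mathbb N$ be a finite set with at least two elements, let $s,\widetilde s\in\mathcal J^{\mathbb Z_+}$, let $m,\widetilde m$ be the corresponding Weyl--Titchmarsh functions, and let $k\in\mathbb Z_+$. Then $$s_j=\widetilde s_j,\qquad 0\le j\le k,$$ if and only if for every $\alpha\in(-\pi,\pi)\setminus\{0\}$ one has $$|m(z)-\widetilde m(z)|=o\big(\exp\{-2(k+1/2)\operatorname{Re}\sqrt{-z}\}\big)$$ as $z\to\infty$ along the ray $\arg(z)=\alpha$.
   Context: $\mathbb Z_+=\{0,1,2,\dots\}$, $\mathbb R_+=(0,\infty)$. $\sqrt{\cdot}$ is the principal branch of the square root (with $\arg\in(-\pi,\pi]$), so $\operatorname{Re}\sqrt{-z}>0$ for $z\in\mathbb C\setminus[0,\infty)$. For $s=\{s_n\}_{n\ge0}\in\mathcal J^{\mathbb Z_+}$ put $\mu(x)=\sum_{n=0}^\infty s_n\chi_{[n,n+1)}(x)$ and $\tau=-\frac1{\mu(x)}\left(\frac{d}{dx}\mu(x)\frac{d}{dx}\right)$ on $\mathbb R_+$. Solutions $u$ of $\tau u=zu$ are required to have $u$ and $\mu u'$ locally absolutely continuous on $[0,\infty)$. For $z\in\mathbb C$, the Dirichlet and Neumann solutions $\varphi(z,\cdot),\theta(z,\cdot)$ of $\tau u=zu$ are determined by $$\varphi(z,0)=\mu(0)\theta'(z,0)=0,\qquad \mu(0)\varphi'(z,0)=\theta(z,0)=1 .$$ For $z\in\mathbb C\setminus\mathbb R$ there is a unique up to scalar multiples nonzero solution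 of $\tau u=zu$ in $L^2(\mathbb R_+;\mu)$, and the Weyl--Titchmarsh function $m(z)\in\mathbb C$ is the unique number such that $\psi(z,\cdot)=\theta(z,\cdot)+m(z)\varphi(z,\cdot)\in L^2(\mathbb R_+;\mu)$. $\widetilde m$ is defined in the same way from $\widetilde s$. *)

(* Defs.v *)
From mathcomp Require Import all_boot all_order all_algebra finmap.
From mathcomp Require Import all_classical all_reals all_analysis.
From mathcomp Require Export complex.

Set Implicit Arguments.
Unset Strict Implicit.
Unset Printing Implicit Defensive.

Import Order.TTheory GRing.Theory Num.Theory.
Import numFieldNormedType.Exports.
Import ComplexField.

Local Open Scope ring_scope.
Local Open Scope classical_set_scope.
Local Open Scope complex_scope.

(* On [0, +oo[ this is sum_n s_n chi_[n, n+1[, because truncn x = n exactly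
   when n <= x < n + 1; values at x < 0 are never used. *)
Definition weight (R : realType) (s : nat -> nat) (x : R) : R :=
  (s (Num.truncn x))%:R.

(* The derivative at x of a complex-valued function of a real variable. *)
Definition is_cderive (R : realType) (f : R -> R[i]) (x : R) (df : R[i]) :
    Prop :=
  is_derive x 1 (fun t => complex.Re (f t)) (complex.Re df) /\
  is_derive x 1 (fun t => complex.Im (f t)) (complex.Im df).

Definition abs_cont (R : realType) (a b : R) (f : R -> R[i]) : Prop :=
  forall e : R, 0 < e -> exists2 d : R, 0 < d &
    forall (n : nat) (x y : 'I_n -> R),
      (forall i, [/\ a <= x i, x i <= y i & y i <= b]) ->
      trivIset [set: 'I_n] (fun i => `]x i, y i[) ->
      \sum_(i < n) (y i - x i) < d ->
      \sum_(i < n) Normc.normc (f (y i) - f (x i)) < e.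

Definition loc_abs_cont (R : realType) (f : R -> R[i]) : Prop :=
  forall b : R, 0 <= b -> abs_cont 0 b f.

(* u solves - (mu u')' / mu = z u.  The function mu u' is only defined almost
   everywhere, so its locally absolutely continuous representative v is carried
   along; in particular (mu u')(0) means v 0. *)
Definition is_solution (R : realType) (s : nat -> nat) (z : R[i])
    (u v : R -> R[i]) : Prop :=
  [/\ loc_abs_cont u, loc_abs_cont v,
      {ae @lebesgue_measure R, forall x, 0 < x ->
        exists2 du, is_cderive u x du & v x = (weight s x)%:C * du} &
      {ae @lebesgue_measure R, forall x, 0 < x ->
        exists2 dv, is_cderive v x dv &
          - ((weight s x)%:C)^-1 * dv = z * u x}].

Definition is_dirichlet (R : realType) (s : nat -> nat) (z : R[i])
    (phi : R -> R[i]) : Prop :=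
  exists v, [/\ is_solution s z phi v, phi 0 = 0 & v 0 = 1].

Definition is_neumann (R : realType) (s : nat -> nat) (z : R[i])
    (theta : R -> R[i]) : Prop :=
  exists v, [/\ is_solution s z theta v, theta 0 = 1 & v 0 = 0].

Definition in_L2 (R : realType) (s : nat -> nat) (u : R -> R[i]) : Prop :=
  [/\ measurable_fun (`]0, +oo[ : set R) (fun x => complex.Re (u x)),
      measurable_fun (`]0, +oo[ : set R) (fun x => complex.Im (u x)) &
      (\int[@lebesgue_measure R]_(x in `]0%R, +oo[)
         ((Normc.normc (u x)) ^+ 2 * weight s x)%:E < +oo)%E].

(* Values at real z are irrelevant. *)
Definition is_weyl_titchmarsh (R : realType) (s : nat -> nat)
    (m : R[i] -> R[i]) : Prop :=
  forall z : R[i], complex.Im z != 0 ->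
  exists phi theta : R -> R[i],
    [/\ is_dirichlet s z phi, is_neumann s z theta &
        in_L2 s (fun x => theta x + m z * phi x)].

Definition ray (R : realType) (alpha r : R) : R[i] :=
  (r * cos alpha) +i* (r * sin alpha).

Canonical pinfty_filter_on (R : numFieldType) :=
  FilterType (pinfty_nbhs R) (@filter_filter _ _ (@proper_pinfty_nbhs R)).

(* Main.v *)
Require Import Defs.
From mathcomp Require Import all_boot all_order all_algebra finmap.
From mathcomp Require Import all_classical all_reals all_analysis.
From mathcomp Require Import measurable_realfun.
From mathcomp Require Import ring lra.

Set Implicit Arguments.
Unset Strict Implicit.
Unset Printing Implicit Defensive.

Import Order.TTheory GRing.Theory Num.Theory.
Import numFieldNormedType.Exports.
Import ComplexField.

Local Open Scope ring_scope.
Local Open Scope classical_set_scope.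
Local Open Scope complex_scope.

(** Put w = sqrt(-z), so that Re w > 0.  On the cell [n, n+1[ the weight is the
    constant s n, and a solution is a combination of exp (w (x - n)) and
    exp (- w (x - n)), with coefficients proportional to
    a n = u n + v n / (s n w) and b n = u n - v n / (s n w), where v = mu u'.
    This is where absolute continuity enters: times the inverse exponential,
    u + v / (s n w) and u - v / (s n w) are absolutely continuous functions with
    zero derivative almost everywhere, hence constant ([rabs_cont_derive0]).

    At n + 1 both u and v are continuous while s jumps, so the reflection
    coefficients r n = a n / b n of the Weyl solution are linked by a Moebius map
    with p = s n and q = s (n+1),
      r n = E (rho + r (n+1)) / (1 + rho r (n+1)),
      rho = (p - q) / (p + q),   E = exp (- 2 w).
    The flux s n (|a n|^2 - |b n|^2) is nondecreasing in n.  Were it ever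
    positive, |u|^2 mu would be bounded below by a positive constant on the right
    half of every later cell, and u would not be square integrable ([flux_le0]).
    Hence |r n| <= 1 for all n, and then |r n| <= |E|, because the Moebius map
    sends the disc into itself.  Finally m = s 0 w (r 0 - 1) / (r 0 + 1)
    ([weyl_reflection]).

    All entries lie in [1, M], so everything is uniform.  One step with common p
    and q multiplies the difference of two reflection coefficients by |E| up to
    factors M^2 ([step_diff]), and the first step at which the two sequences
    branch creates a difference comparable to |E| ([step_split]).  If s and st
    agree up to k, then |m - mt| <= C |w| |E|^(k+1) ([m_diff_upper]); if they
    first differ at j, then |m - mt| >= c |w| |E|^j ([m_diff_lower]).  Since
    |E| = exp (- 2 Re w) and both |w| and Re w grow like the square root of |z|
    on a ray, the bound exp (- 2 (k + 1/2) Re w) lies strictly between the cases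
    j <= k and agreement up to k. *)

(** * Absolutely continuous real functions *)

Section AC.
Variable R : realType.
Implicit Types (a b x : R) (f g : R -> R).

(** The finite family is a list of intervals running from right to left: adding
    an interval on the right is then a cons, and disjointness only compares
    endpoints. *)
Definition rabs_cont a b f := forall e : R, 0 < e -> exists2 d : R, 0 < d &
  forall I : seq (R * R),
    all (fun p => [&& a <= p.1, p.1 <= p.2 & p.2 <= b]) I ->
    pairwise (fun p q => q.2 <= p.1) I ->
    \sum_(p <- I) (p.2 - p.1) < d ->
    \sum_(p <- I) `|f p.2 - f p.1| < e.

Lemma rabs_contW a b a' b' f : a <= a' -> b' <= b -> rabs_cont a b f -> rabs_cont a' b' f.
Proof.
move=> aa bb fac e e0; have [d d0 H] := fac _ e0; exists d => // I /allP hI.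
apply: H; apply/allP => p /hI /and3P[h1 h2 h3].
by rewrite (le_trans aa h1) h2 (le_trans h3 bb).
Qed.

(** The common source of the closure properties: sums and products of absolutely
    continuous functions satisfy such an increment bound. *)
Lemma rabs_cont_lincomb a b f g h (K L : R) : 0 <= K -> 0 <= L ->
  rabs_cont a b f -> rabs_cont a b g ->
  (forall x y, a <= x -> x <= y -> y <= b ->
     `|h y - h x| <= K * `|f y - f x| + L * `|g y - g x|) ->
  rabs_cont a b h.
Proof.
move=> K0 L0 fac gac hh e e0.
have K1 : 0 < K + 1 by lra.
have L1 : 0 < L + 1 by lra.
have [d d0 Hd] := fac (e / 2 / (K + 1)) (divr_gt0 (divr_gt0 e0 (ltr0Sn _ _)) K1).
have [d' d'0 Hd'] := gac (e / 2 / (L + 1)) (divr_gt0 (divr_gt0 e0 (ltr0Sn _ _)) L1).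
exists (Num.min d d'); first by rewrite lt_min d0.
move=> I hI pI; rewrite lt_min => /andP[s1 s2].
have := Hd I hI pI s1; have := Hd' I hI pI s2.
rewrite !ltr_pdivlMr // => u1 u2.
apply: (@le_lt_trans _ _ (K * (\sum_(p <- I) `|f p.2 - f p.1|) +
                          L * (\sum_(p <- I) `|g p.2 - g p.1|))).
  rewrite !mulr_sumr -big_split /= big_seq [leRHS]big_seq.
  by apply: ler_sum => p /(allP hI) /and3P[h1 h2 h3]; exact: hh.
have F0 : 0 <= \sum_(p <- I) `|f p.2 - f p.1| by apply: sumr_ge0.
have G0 : 0 <= \sum_(p <- I) `|g p.2 - g p.1| by apply: sumr_ge0.
nra.
Qed.

Lemma rabs_cont_lipschitz a b f (K : R) :
  (forall x y, a <= x -> x <= y -> y <= b -> `|f y - f x| <= K * (y - x)) ->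
  rabs_cont a b f.
Proof.
move=> fK e e0; exists (e / (`|K| + 1)).
  by rewrite divr_gt0 // ltr_wpDl.
move=> I hI _; rewrite ltr_pdivlMr ?ltr_wpDl // => sI.
apply: (le_lt_trans _ sI); rewrite mulr_suml.
rewrite big_seq [leRHS]big_seq.
apply: ler_sum => p /(allP hI) /and3P[h1 h2 h3]; apply: (le_trans (fK _ _ h1 h2 h3)).
have := ler_norm K; nra.
Qed.

Lemma rabs_cont_bounded a b f : rabs_cont a b f ->
  exists2 K, 0 <= K & forall x, a <= x <= b -> `|f x| <= K.
Proof.
move=> /(_ 1 ltr01)[d d0 Hd].
(* Moving left by steps of length d / 2 changes f by less than 1 per step. *)
have step n : forall x, a <= x <= b -> x - a <= n%:R * (d / 2) ->
    `|f x| <= `|f a| + n%:R.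
  elim: n => [|n IH] x /andP[ax xb] xn.
    have -> : x = a by apply/eqP; rewrite eq_le ax andbT; move: xn; rewrite mul0r; lra.
    by rewrite addr0.
  set t := Num.max a (x - d / 2).
  have [tx [at_ ht]] : t <= x /\ a <= t /\ x - d / 2 <= t.
    rewrite /t; have [h|h] := leP a (x - d / 2); split; [lra|split; lra|lra|split; lra].
  have IHt := IH t.
  have {IHt}ft : `|f t| <= `|f a| + n%:R.
    apply: IHt; first by rewrite at_ (le_trans tx xb).
    rewrite /t; have [h|h] := leP a (x - d / 2).
      move: xn; rewrite -[n.+1%:R](natr1 n); lra.
    by rewrite subrr mulr_ge0 // divr_ge0 // ltW.
  have := Hd [:: (t, x)]; rewrite /= !big_seq1 /= at_ tx xb => /(_ isT isT) hh.
  have {hh} : `|f x - f t| < 1 by apply: hh; lra.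
  have := ler_normD (f x - f t) (f t); rewrite subrK -[n.+1%:R](natr1 n).
  lra.
exists (`|f a| + (Num.truncn ((b - a) / (d / 2))).+1%:R).
  by rewrite addr_ge0.
move=> x /andP[ax xb]; apply: step; first by rewrite ax.
rewrite -ler_pdivrMr ?divr_gt0 //; apply: (@le_trans _ _ ((b - a) / (d / 2))).
  by rewrite ler_pM2r ?invr_gt0 ?divr_gt0 // lerD2r.
by apply/ltW; rewrite truncnS_gt.
Qed.

Lemma rabs_contD a b f g : rabs_cont a b f -> rabs_cont a b g -> rabs_cont a b (fun x => f x + g x).
Proof.
move=> fac gac; apply: (@rabs_cont_lincomb a b f g _ 1 1) => // x y _ _ _.
by rewrite !mul1r opprD addrACA; exact: ler_normD.
Qed.

Lemma rabs_contM a b f g : rabs_cont a b f -> rabs_cont a b g -> rabs_cont a b (fun x => f x * g x).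
Proof.
move=> fac gac.
have [K K0 fK] := rabs_cont_bounded fac; have [L L0 gL] := rabs_cont_bounded gac.
apply: (@rabs_cont_lincomb a b f g _ L K) => // x y ax xy yb.
have -> : f y * g y - f x * g x = g y * (f y - f x) + f x * (g y - g x) by ring.
apply: (le_trans (ler_normD _ _)); rewrite !normrM.
by apply: lerD; apply: ler_wpM2r => //; [apply: gL|apply: fK]; apply/andP; split => //;
  apply: le_trans ax _ || apply: le_trans xy _.
Qed.

Lemma rabs_cont_cst a b (c : R) : rabs_cont a b (fun=> c).
Proof.
by apply: (@rabs_cont_lipschitz _ _ _ 0) => x y _ _ _; rewrite subrr normr0 mul0r.
Qed.

Lemma rabs_cont_bounded_deriv a b f (df : R -> R) (K : R) :
  (forall x, is_derive x 1 f (df x)) ->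
  (forall x, a <= x <= b -> `|df x| <= K) -> rabs_cont a b f.
Proof.
move=> fd dfK; apply: (@rabs_cont_lipschitz _ _ _ K) => x y ax xy yb.
have fc : {within `[x, y], continuous f}.
  apply: derivable_within_continuous => z _; exact: ex_derive.
have [c] := MVT_segment xy (fun x _ => fd x) fc.
rewrite in_itv /= => /andP[xc cy] ->; rewrite normrM (ger0_norm (_ : 0 <= y - x)) ?subr_ge0 //.
by apply: ler_wpM2r; rewrite ?subr_ge0 // dfK // (le_trans ax xc) (le_trans cy yb).
Qed.

Lemma rabs_cont_expR a b (k l : R) : rabs_cont a b (fun x => expR (k * x + l)).
Proof.
apply: (@rabs_cont_bounded_deriv _ _ _ (fun x => expR (k * x + l) * k)
          (expR (`|k| * (`|a| + `|b|) + l) * `|k|)) => [x|x /andP[ax xb]].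
  by apply: is_derive_eq; rewrite /GRing.scale /=; ring.
rewrite normrM ler_wpM2r // ger0_norm ?expR_ge0 // ler_expR lerD2r.
apply: (le_trans (ler_norm _)); rewrite normrM ler_wpM2l //.
have := ler_norm b; have := ler_norm (- a); rewrite normrN.
have := normr_ge0 a; have := normr_ge0 b.
by rewrite ler_norml => *; apply/andP; split; lra.
Qed.

Lemma rabs_cont_cos a b (k l : R) : rabs_cont a b (fun x => cos (k * x + l)).
Proof.
apply: (@rabs_cont_bounded_deriv _ _ _ (fun x => - sin (k * x + l) * k) `|k|) => x.
  by apply: is_derive_eq; rewrite /GRing.scale /=; ring.
move=> _; rewrite normrM ler_piMl // normrN ler_norml.
by rewrite sin_geN1 sin_le1.
Qed.

Lemma rabs_cont_sin a b (k l : R) : rabs_cont a b (fun x => sin (k * x + l)).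
Proof.
apply: (@rabs_cont_bounded_deriv _ _ _ (fun x => cos (k * x + l) * k) `|k|) => x.
  by apply: is_derive_eq; rewrite /GRing.scale /=; ring.
move=> _; rewrite normrM ler_piMl // ler_norml.
by rewrite cos_geN1 cos_le1.
Qed.

End AC.

(** * Absolute continuity and zero derivative almost everywhere *)

Section ZeroDeriv.
Variable R : realType.
Implicit Types (a b x : R) (f g : R -> R).
Notation mu := (@lebesgue_measure R).

Lemma is_derive0_local f (c e : R) : 0 < e -> is_derive c 1 f 0 ->
  exists2 h : R, 0 < h & forall y, `|y - c| < h -> `|f y - f c| <= e * `|y - c|.
Proof.
move=> e0 [fd f0].
have : (fun t => t^-1 *: ((f \o shift c) (t *: 1) - f c)) @ 0^' --> 'D_1 f c.
  exact: fd.
rewrite f0.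
move/cvgr0Pnorm_le => /(_ _ e0) [h /= h0 H].
exists h => // y yc; have [->|yNc] := eqVneq y c.
  by rewrite !subrr normr0 mulr0.
have yc0 : y - c != 0 by rewrite subr_eq0.
have := H (y - c); rewrite /= sub0r normrN => /(_ yc yc0).
rewrite /GRing.scale /= mulr1 subrK normrM normfV ler_pdivrMl ?normr_gt0 //.
by rewrite mulrC.
Qed.

Lemma open_fat_null (N : set R) (d : R) : measurable N -> mu N = 0%E -> 0 < d ->
  exists U : set R, [/\ open U, N `<=` U & (mu U < d%:E)%E].
Proof.
move=> mN N0 d0.
have Noo : (mu N < +oo)%E by rewrite N0.
have [U [oU NU Ud]] := lebesgue_regularity_outer mN Noo d0.
exists U; split => //; rewrite -(setDUK NU).
apply: le_lt_trans Ud.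
have mUN : measurable (U `\` N) by apply: measurableD => //; exact: open_measurable.
by rewrite -[leRHS]add0e -N0; exact: measureU2.
Qed.

(** The bookkeeping of a Cousin-type argument on [[a, t]]: the increment of f is
    paid at rate e per unit length, except on disjoint intervals contained in U,
    which later is a small open set covering the exceptional points.  The third
    clause records that the total length of these intervals is at most the
    measure of U. *)
Definition chain a f (U : set R) (e t : R) :=
  exists I : seq (R * R),
  [/\ all (fun p => [&& a <= p.1, p.1 <= p.2 & p.2 <= t]) I,
      pairwise (fun p q => q.2 <= p.1) I,
      ((\sum_(p <- I) (p.2 - p.1))%:E <= mu (U `&` `]a, t]))%E &
      `|f t - f a| <= e * (t - a) + \sum_(p <- I) `|f p.2 - f p.1|].

Lemma chain_still a f U (e t t' : R) : open U -> a <= t -> t <= t' ->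
  `|f t' - f t| <= e * (t' - t) -> chain a f U e t -> chain a f U e t'.
Proof.
move=> oU at_ tt ft [I [I1 I2 I3 I4]]; exists I; split => //.
- apply/allP => p /(allP I1) /and3P[-> -> h]; exact: le_trans tt.
- apply: (le_trans I3); apply: le_measure; rewrite ?inE.
  + by apply: measurableI => //; exact: open_measurable.
  + by apply: measurableI => //; exact: open_measurable.
  + apply: setIS => x /=; rewrite !in_itv /= => /andP[-> h]; exact: le_trans tt.
have := ler_normD (f t' - f t) (f t - f a); rewrite addrA subrK; lra.
Qed.

Lemma chain_jump a f U (e t t' : R) : open U -> 0 <= e -> a <= t -> t <= t' ->
  `]t, t'] `<=` U -> chain a f U e t -> chain a f U e t'.
Proof.
move=> oU e0 at_ tt tU [I [I1 I2 I3 I4]]; exists ((t, t') :: I); split.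
- rewrite /= at_ tt lexx /=.
  apply/allP => p /(allP I1) /and3P[-> -> h]; exact: le_trans tt.
- by rewrite /= I2 andbT; apply/allP => p /(allP I1) /and3P[_ _ ->].
- rewrite big_cons /=.
  have -> : U `&` `]a, t'] = (U `&` `]a, t]) `|` `]t, t'].
    apply/seteqP; split => x /=; rewrite !in_itv /=.
      move=> [Ux /andP[-> xt]]; have [xt'|xt'] := leP x t; [by left|by right].
    move=> [[Ux /andP[-> xt]]|/andP[xt xt']].
      by split => //=; exact: le_trans tt.
    split; first by apply: tU; rewrite /= in_itv /= xt.
    by rewrite (le_lt_trans at_ xt).
  rewrite measureU //=.
  + rewrite lebesgue_measure_itv /= lte_fin.
    have [h|h] := ltP t t'.
      by rewrite EFinD addeC leeD // -EFinB.
    have -> : t' - t = 0 by lra.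
    by rewrite add0r adde0.
  + by apply: measurableI => //; exact: open_measurable.
  + apply/seteqP; split => x //=; rewrite !in_itv /= => -[[_ /andP[_ h]] /andP[h' _]].
    by move: (lt_le_trans h' h); rewrite ltxx.
rewrite big_cons /=.
have := ler_normD (f t' - f t) (f t - f a); rewrite addrA subrK.
have : 0 <= e * (t' - t) by rewrite mulr_ge0 // subr_ge0.
lra.
Qed.

(** The supremum c of the reachable t is b, since one can always step across c:
    by [chain_jump] if c lies in U, by [chain_still] if the derivative at c
    vanishes. *)
Lemma chain_end a b f (U : set R) (e : R) : a <= b -> 0 < e -> open U ->
  (forall x, a <= x <= b -> ~ U x -> is_derive x 1 f 0) ->
  chain a f U e b.
Proof.
move=> ab e0 oU fU.
pose S := [set t | a <= t <= b /\ chain a f U e t].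
have Sa : S a.
  split; first by rewrite lexx ab.
  exists [::]; split => //; rewrite !big_nil ?measure_ge0 //.
  by rewrite !subrr mulr0 add0r normr0.
have Sub : has_ubound S by exists b => t [/andP[]].
have Ssup : has_sup S by split => //; exists a.
set c := sup S.
have ac : a <= c by apply: (ub_le_sup Sub).
have cb : c <= b by apply: ge_sup => // [|t [/andP[]]//]; exists a.
have [h h0 H] : exists2 h : R, 0 < h &
    forall t t', c - h < t -> t <= c -> c <= t' -> t' < c + h -> t' <= b ->
      S t -> S t'.
  have [Uc|Uc] := pselect (U c).
    have /nbhs_ballP[h /= h0 hU] : nbhs c U by apply: open_nbhs_nbhs.
    exists h => // t t' h1 h2 h3 h4 h5 [/andP[h6 h7] ch]; split.
      by rewrite h5 andbT; lra.
    apply: (@chain_jump _ _ _ _ t t') => //; [exact: ltW|lra|].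
    move=> x /=; rewrite in_itv /= => /andP[tx xt]; apply: hU.
    by rewrite /ball /= ltr_norml; apply/andP; split; lra.
  have [h h0 H] := is_derive0_local e0 (fU c (introT andP (conj ac cb)) Uc).
  exists h => // t t' h1 h2 h3 h4 h5 [/andP[h6 h7] ch]; split.
    by rewrite h5 andbT; lra.
  apply: (@chain_still _ _ _ _ t t') => //; [lra|].
  have F1 : `|f t' - f c| <= e * (t' - c).
    by rewrite -[X in e * X]ger0_norm ?subr_ge0 // H // ger0_norm ?subr_ge0 //; lra.
  have F2 : `|f c - f t| <= e * (c - t).
    rewrite -[X in e * X]ger0_norm ?subr_ge0 // (distrC (f c)) (distrC c) H //.
    by rewrite distrC ger0_norm ?subr_ge0 //; lra.
  have := ler_normD (f t' - f c) (f c - f t); rewrite addrA subrK; lra.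
have [t St ct] := sup_adherent h0 Ssup.
have tc : t <= c by apply: (ub_le_sup Sub).
have [cb'|bc] := ltP c b; last first.
  have -> : b = c by apply/eqP; rewrite eq_le bc cb.
  by case: (H t c ct tc) => //; lra.
have : S (Num.min b (c + h / 2)).
  have [hb|hb] := leP b (c + h / 2); apply: (H t _ ct tc) => //; lra.
move=> /(ub_le_sup Sub); rewrite -/c ge_min.
by have [hb|hb] := leP b c; [lra|rewrite /=; lra].
Qed.

(** Cover the exceptional null set by an open U so small that, by absolute
    continuity, the intervals of a chain inside U carry an increment less than e.
    The endpoints, where nothing is known on the derivative, also go into U. *)
Lemma rabs_cont_derive0 a b f : a <= b -> rabs_cont a b f ->
  {ae mu, forall x, a < x < b -> is_derive x 1 f 0} -> f b = f a.
Proof.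
move=> ab fac [N [mN N0 fN]].
apply/eqP; rewrite -subr_eq0 -normr_le0; apply/ler_addgt0Pr => e e0; rewrite add0r.
pose e' := e / (b - a + 1).
have e'0 : 0 < e' by rewrite divr_gt0 //; lra.
have [d d0 H] := fac _ e'0.
have ma : measurable [set a; b] by apply: measurableU.
have ab0 : mu [set a; b] = 0%E.
  apply/eqP; rewrite -measure_le0 -[leRHS]adde0.
  by rewrite -[X in (X + _)%E](lebesgue_measure_set1 a)
    -[X in (_ + X)%E](lebesgue_measure_set1 b); exact: measureU2.
have mN' : measurable (N `|` [set a; b]) by apply: measurableU.
have N'0 : mu (N `|` [set a; b]) = 0%E.
  apply/eqP; rewrite -measure_le0 -[leRHS]adde0.
  by rewrite -[X in (X + _)%E]N0 -[X in (_ + X)%E]ab0; exact: measureU2.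
have [U [oU NU Ud]] := open_fat_null mN' N'0 d0.
have [|I [I1 I2 I3 I4]] := @chain_end a b f U e' ab e'0 oU.
  move=> x /andP[ax xb] nU; apply: contrapT => nd; apply: nU; apply: NU.
  have [->|xa] := eqVneq x a; first by right; left.
  have [->|xb'] := eqVneq x b; first by right; right.
  left; apply: fN => /= /(_ _)P; apply: nd; apply: P.
  by rewrite !lt_def (eq_sym b) xa xb' ax xb.
have : \sum_(p <- I) (p.2 - p.1) < d.
  rewrite -lte_fin (le_lt_trans I3) // (le_lt_trans _ Ud) //.
  apply: le_measure; rewrite ?inE; [|exact: open_measurable|exact: subIsetl].
  by apply: measurableI => //; exact: open_measurable.
move=> /(H I I1 I2) hI.
apply: (le_trans I4); apply: (@le_trans _ _ (e' * (b - a) + e')); first by lra.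
by rewrite -{2}[e']mulr1 -mulrDr /e' divfK // gt_eqF //; lra.
Qed.

End ZeroDeriv.

(** * The equation on one cell *)

Section Cell.
Variable R : realType.
Implicit Types (a b x : R) (p q : R -> R) (u v F : R -> R[i]) (c w z : R[i]).
Notation mu := (@lebesgue_measure R).
Local Notation Re := complex.Re.
Local Notation Im := complex.Im.

Lemma ae_imply (P Q : R -> Prop) : (forall x, P x -> Q x) ->
  (\forall x \ae mu, P x) -> \forall x \ae mu, Q x.
Proof. by move=> PQ; exact: (@filterS _ _ (ae_filter_ringOfSetsType mu)). Qed.

Lemma ae_imply2 (P Q S : R -> Prop) : (forall x, P x -> Q x -> S x) ->
  (\forall x \ae mu, P x) -> (\forall x \ae mu, Q x) -> \forall x \ae mu, S x.
Proof. by move=> PQ; exact: (@filterS2 _ _ (ae_filter_ringOfSetsType mu)). Qed.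

(** The real form of F' = c F with c = al + i be and F = p + i q: the real and
    imaginary parts of exp (- c (x - a)) F have zero derivative. *)
Lemma rabs_cont_rotation a b (al be : R) p q : rabs_cont a b p -> rabs_cont a b q ->
  {ae mu, forall x, a < x < b -> is_derive x 1 p (al * p x - be * q x) /\
                                 is_derive x 1 q (be * p x + al * q x)} ->
  forall x, a <= x <= b ->
  p x = expR (al * (x - a)) * (cos (be * (x - a)) * p a - sin (be * (x - a)) * q a) /\
  q x = expR (al * (x - a)) * (sin (be * (x - a)) * p a + cos (be * (x - a)) * q a).
Proof.
move=> pac qac pq x /andP[ax xb].
pose e y := expR (- al * y + al * a).
pose co y := cos (be * y + - (be * a)).
pose si y := sin (be * y + - (be * a)).
pose G y := e y * (co y * p y + si y * q y).
pose H y := e y * (co y * q y + (- 1) * si y * p y).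
have eac : rabs_cont a x e by exact: rabs_cont_expR.
have coac : rabs_cont a x co by exact: rabs_cont_cos.
have siac : rabs_cont a x si by exact: rabs_cont_sin.
have pax : rabs_cont a x p by exact: rabs_contW pac.
have qax : rabs_cont a x q by exact: rabs_contW qac.
have Gac : rabs_cont a x G.
  by apply: rabs_contM => //; apply: rabs_contD; apply: rabs_contM.
have Hac : rabs_cont a x H.
  by apply: rabs_contM => //; apply: rabs_contD; apply: rabs_contM => //; apply: rabs_contM => //; exact: rabs_cont_cst.
have Gx : G x = G a.
  apply: rabs_cont_derive0 => //; move: pq; apply: ae_imply => y pq /andP[ay yx].
  have [|pd qd] := pq; first by rewrite ay (lt_le_trans yx xb).
  by apply: is_derive_eq; rewrite /e /co /si /GRing.scale /=; ring.
have Hx : H x = H a.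
  apply: rabs_cont_derive0 => //; move: pq; apply: ae_imply => y pq /andP[ay yx].
  have [|pd qd] := pq; first by rewrite ay (lt_le_trans yx xb).
  by apply: is_derive_eq; rewrite /e /co /si /GRing.scale /=; ring.
move: Gx Hx; rewrite /G /H /e /co /si.
have -> : - al * a + al * a = 0 by ring.
rewrite subrr expR0 cos0 sin0 !mul1r !mul0r mulr0 mul0r !addr0 => <- <-.
have -> : - al * x + al * a = - (al * (x - a)) by ring.
have -> : be * x - be * a = be * (x - a) by ring.
have /eqP := cos2Dsin2 (be * (x - a)); rewrite -subr_eq0 => /eqP cs.
have es : expR (al * (x - a)) * expR (- (al * (x - a))) = 1 by rewrite expRxMexpNx_1.
move: cs es; set C := cos _; set S := sin _; set X := expR _; set Y := expR _ => cs es.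
have cs' : C ^+ 2 + S ^+ 2 = 1 by apply/eqP; rewrite -subr_eq0 cs.
split.
  transitivity ((X * Y) * ((C ^+ 2 + S ^+ 2) * p x)); last by ring.
  by rewrite es cs' !mul1r.
transitivity ((X * Y) * ((C ^+ 2 + S ^+ 2) * q x)); last by ring.
by rewrite es cs' !mul1r.
Qed.

Definition cexp c : R[i] := (expR (Re c) * cos (Im c)) +i* (expR (Re c) * sin (Im c)).

Lemma normc_cexp c : Normc.normc (cexp c) = expR (Re c).
Proof.
rewrite /cexp /= !exprMn -mulrDr cos2Dsin2 mulr1 sqrtr_sqr ger0_norm //.
Qed.

Lemma cexp_neq0 c : cexp c != 0.
Proof.
apply/eqP => c0; have := normc_cexp c; rewrite c0 Normc.normc0 => /esym/eqP.
by rewrite gt_eqF ?expR_gt0.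
Qed.

Definition cabs_cont a b F := rabs_cont a b (fun x => Re (F x)) /\
  rabs_cont a b (fun x => Im (F x)).

Lemma abs_cont_cabs a b a' b' F : a <= a' -> b' <= b -> abs_cont a b F -> cabs_cont a' b' F.
Proof.
move=> aa bb FA.
have ReIm (y : R[i]) : `|Re y| <= Normc.normc y /\ `|Im y| <= Normc.normc y.
  case: y => y1 y2 /=; rewrite -!sqrtr_sqr; split; apply: ler_wsqrtr.
    by rewrite lerDl sqr_ge0.
  by rewrite lerDr sqr_ge0.
suff key (g : R[i] -> R) : (forall x y : R[i], `|g y - g x| <= Normc.normc (y - x)) ->
    rabs_cont a' b' (fun x => g (F x)).
  split; apply: key => x y; have := ReIm (y - x); case: x y => [x1 x2][y1 y2] /= [] //.
move=> gF e e0; have [d d0 H] := FA _ e0; exists d => // I hI pI sI.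
pose P i := nth (0, 0) I i.
have h i : (i < size I)%N -> [&& a' <= (P i).1, (P i).1 <= (P i).2 & (P i).2 <= b'].
  by move=> iI; apply: (allP hI); exact: mem_nth.
have dis i j : (i < j < size I)%N -> (P j).2 <= (P i).1.
  move=> /andP[ij jI]; move/(pairwiseP (0, 0)): pI; apply => //.
  by rewrite inE (ltn_trans ij jI).
(* Lists of intervals are read as families indexed by positions. *)
have := H (size I) (fun i => (P i).1) (fun i => (P i).2).
rewrite [in X in X -> _]/= => HH.
apply: (@le_lt_trans _ _ (\sum_(i < size I) Normc.normc (F (P i).2 - F (P i).1))).
  rewrite (big_nth (0, 0)) big_mkord; apply: ler_sum => i _; exact: gF.
apply: HH.
- move=> i; have /and3P[h1 h2 h3] := h _ (ltn_ord i).
  by split => //; [exact: le_trans aa h1|exact: le_trans h3 bb].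
- move=> i j _ _ [t [/=]]; rewrite !in_itv /= => /andP[i1 i2] /andP[j1 j2].
  apply/val_inj; case: (ltngtP i j) => // ij.
    have E := dis i j (introT andP (conj ij (ltn_ord j))).
    by move: (lt_trans (le_lt_trans E i1) j2); rewrite ltxx.
  have E := dis j i (introT andP (conj ij (ltn_ord i))).
  by move: (lt_trans (le_lt_trans E j1) i2); rewrite ltxx.
by move: sI; rewrite (big_nth (0, 0)) big_mkord.
Qed.

Lemma cabs_cont_comb a b c u v : cabs_cont a b u -> cabs_cont a b v ->
  cabs_cont a b (fun x => u x + c * v x).
Proof.
case: c => c1 c2 [u1 u2] [v1 v2]; split.
  have := rabs_contD u1 (rabs_contD (rabs_contM (rabs_cont_cst a b c1) v1) (rabs_contM (rabs_cont_cst a b (- c2)) v2)).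
  by congr rabs_cont; apply/funext => x /=; case: (u x) (v x) => [? ?][? ?] /=; ring.
have := rabs_contD u2 (rabs_contD (rabs_contM (rabs_cont_cst a b c1) v2) (rabs_contM (rabs_cont_cst a b c2) v1)).
by congr rabs_cont; apply/funext => x /=; case: (u x) (v x) => [? ?][? ?] /=; ring.
Qed.

Lemma is_cderive_comb c u v x (du dv : R[i]) : is_cderive u x du -> is_cderive v x dv ->
  is_cderive (fun x => u x + c * v x) x (du + c * dv).
Proof.
case: c du dv => c1 c2 [du1 du2] [dv1 dv2] [/= u1 u2] [/= v1 v2]; split => /=.
  have -> : (fun t => Re (u t + (c1 +i* c2) * v t)) =
      (fun t => Re (u t) + (c1 * Re (v t) - c2 * Im (v t))).
    by apply/funext => t; case: (u t) (v t) => [? ?][? ?] /=; ring.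
  by apply: is_derive_eq; rewrite /GRing.scale /=; ring.
have -> : (fun t => Im (u t + (c1 +i* c2) * v t)) =
    (fun t => Im (u t) + (c1 * Im (v t) + c2 * Re (v t))).
  by apply/funext => t; case: (u t) (v t) => [? ?][? ?] /=; ring.
by apply: is_derive_eq; rewrite /GRing.scale /=; ring.
Qed.

Lemma cabs_cont_exp a b c F : cabs_cont a b F ->
  {ae mu, forall x, a < x < b -> is_cderive F x (c * F x)} ->
  forall x, a <= x <= b -> F x = cexp (c * (x - a)%:C) * F a.
Proof.
case: c => al be [F1 F2] FD x axb.
have [|h1 h2] := @rabs_cont_rotation a b al be _ _ F1 F2 _ x axb.
  move: FD; apply: ae_imply => y FD /FD; case.
  by case: (F y) => ? ? /=; rewrite [X in _ -> _ -> _ /\ is_derive _ _ _ X]addrC.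
move: h1 h2; rewrite /cexp /=; case: (F x) (F a) => [? ?][? ?] /= -> ->.
by apply/eqP; rewrite eq_complex /= !mulr0 add0r subr0; apply/andP; split; apply/eqP; ring.
Qed.

Lemma weight_cell (s : nat -> nat) (n : nat) x : n%:R < x < n.+1%:R -> weight s x = (s n)%:R.
Proof.
move=> /andP[h1 h2]; rewrite /weight; congr (_%:R); congr s; apply/eqP.
by rewrite truncn_eq ?(ltW h1) // (le_trans _ (ltW h1)).
Qed.

(** With w^2 = - z the system u' = v / s, v' = - z s u is diagonalized by
    u + v / (s w) and u - v / (s w), which are multiplied by w and - w under
    differentiation; the boolean e selects the sign. *)
Lemma solution_cell (s : nat -> nat) z w u v (n : nat) (e : bool) :
  is_solution s z u v -> w ^+ 2 = - z -> w != 0 -> (0 < s n)%N ->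
  let k := (-1) ^+ e / ((s n)%:R * w) in
  forall x, n%:R <= x <= n.+1%:R ->
  u x + k * v x = cexp ((-1) ^+ e * w * (x - n%:R)%:C) * (u n%:R + k * v n%:R).
Proof.
move=> [uac vac ud vd] w2 w0 sn0 k.
have n0 : (0 : R) <= n%:R by [].
have n1 : (0 : R) <= n.+1%:R by [].
have sn : (s n)%:R != 0 :> R[i] by rewrite pnatr_eq0 -lt0n.
apply: cabs_cont_exp.
  by apply: cabs_cont_comb; [exact: abs_cont_cabs (uac _ n1)|exact: abs_cont_cabs (vac _ n1)].
move: ud vd; apply: ae_imply2 => x ud vd /andP[nx xn].
have x0 : 0 < x by exact: le_lt_trans nx.
have [du ux vx] := ud x0; have [dv vdx ex] := vd x0.
have wx := @weight_cell s n x (introT andP (conj nx xn)).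
rewrite wx in vx ex.
have snC : ((s n)%:R : R)%:C = (s n)%:R :> R[i] by rewrite rmorph_nat.
rewrite snC in vx ex.
have -> : (-1) ^+ e * w * (u x + k * v x) = du + k * dv.
  have -> : dv = - (s n)%:R * z * u x.
    by rewrite -mulrA -ex; field.
  have -> : z = - w ^+ 2 by rewrite w2 opprK.
  rewrite vx /k.
  have e2 : ((-1) ^+ e : R[i]) * (-1) ^+ e = 1 by rewrite -expr2 sqrr_sign.
  transitivity ((-1) ^+ e * (-1) ^+ e * du + (-1) ^+ e * w * u x).
    by field; rewrite sn w0.
  by rewrite e2; field; rewrite sn w0.
exact: is_cderive_comb.
Qed.

End Cell.

(** * Square integrability against the weight *)

Section L2.
Variable R : realType.
Notation mu := (@lebesgue_measure R).
Local Notation Re := complex.Re.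
Local Notation Im := complex.Im.

Lemma measurable_weight (s : nat -> nat) : measurable_fun (`]0, +oo[ : set R) (weight s : R -> R).
Proof.
pose E n : set R := `]0, +oo[ `&` `[n%:R, n.+1%:R[.
have -> : `]0%R, +oo[%classic = \bigcup_n E n.
  apply/seteqP; split => x; last by move=> [n _ []].
  move=> x0; exists (Num.truncn x) => //; split => //.
  move: x0; rewrite /= !in_itv /= andbT => x0.
  by have /andP[-> ->] := truncn_itv (ltW x0).
apply/measurable_fun_bigcup => n; first exact: measurableI.
apply: (@eq_measurable_fun _ _ _ _ _ (cst ((s n)%:R : R))) => //.
move=> x; rewrite inE /E /= !in_itv /= => -[x0 /andP[h1 h2]].
rewrite /weight; congr (_%:R); congr s; apply/esym/eqP.
by rewrite truncn_eq ?h1 // ltW //; move: x0; rewrite andbT.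
Qed.

(** Only the right halves of the cells are needed: they are disjoint and each
    contributes at least d / 2 to the integral. *)
Lemma in_L2_not_bounded_below (s : nat -> nat) (u : R -> R[i]) (N : nat) (d : R) :
  in_L2 s u -> 0 < d ->
  ~ (forall (n : nat) x, (N <= n)%N -> n%:R + 2^-1 < x < n.+1%:R ->
      d <= Normc.normc (u x) ^+ 2 * (s n)%:R).
Proof.
move=> [mR mI] + d0 ud.
set f := fun x => _%:E.
have f0 x : (0 <= f x)%E by rewrite lee_fin mulr_ge0 ?sqr_ge0 // /weight.
have mf : measurable_fun (`]0, +oo[ : set R) f.
  apply/measurable_EFinP; apply: measurable_funM; last exact: measurable_weight.
  apply: (@eq_measurable_fun _ _ _ _ _ (fun x => Re (u x) ^+ 2 + Im (u x) ^+ 2)).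
    move=> x _; case: (u x) => a b /=; rewrite sqr_sqrtr //.
    by rewrite addr_ge0 ?sqr_ge0.
  by apply: measurable_funD; apply: measurable_funX.
have mfS (A : set R) : A `<=` `]0, +oo[ -> measurable_fun A f.
  by move=> A0; exact: measurable_funS mf.
have step K : ((K%:R * (d / 2))%:E <= \int[mu]_(x in `]0%R, (N + K)%:R[) f x)%E.
  elim: K => [|K IH]; first by rewrite mul0r; exact: integral_ge0.
  pose A : set R := `]0%R, (N + K)%:R[.
  pose B : set R := `](N + K)%:R + 2^-1, (N + K).+1%:R[.
  have mA : measurable A by exact: measurable_itv.
  have mB : measurable B by exact: measurable_itv.
  have NK0 : 0 <= (N + K)%:R :> R by [].
  have NK1 : (N + K).+1%:R = (N + K)%:R + 1 :> R by rewrite -natr1.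
  have half : 0 < (2^-1 : R) < 1 by lra.
  have AB : A `|` B `<=` `]0%R, (N + K.+1)%:R[.
    rewrite addnS /A /B => x [] /=; rewrite !in_itv /= => /andP[h1 h2].
      by rewrite h1 (lt_trans h2) // ltr_nat.
    by rewrite h2 andbT; lra.
  have AB0 : A `|` B `<=` `]0%R, +oo[.
    by move=> x /AB /=; rewrite !in_itv /= => /andP[->].
  apply: (@le_trans _ _ (\int[mu]_(x in A `|` B) f x)%E); last first.
    apply: ge0_subset_integral => //; first exact: measurableU.
    by apply: mfS => x /=; rewrite !in_itv /= => /andP[->].
  rewrite ge0_integral_setU //=; first last.
  - apply/disj_setPS; rewrite /A /B => x [] /=; rewrite !in_itv /=; lra.
  - exact: mfS.
  rewrite -natr1 mulrDl mul1r EFinD; apply: leeD; first exact: IH.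
  apply: (@le_trans _ _ (\int[mu]_(x in B) (cst d%:E x))%E).
    rewrite integral_cst //= lebesgue_measure_itv /= lte_fin ifT; last by lra.
    by rewrite -EFinB -EFinM lee_fin NK1; lra.
  apply: ge0_le_integral => //.
  - by move=> x _; rewrite lee_fin ltW.
  - by apply: mfS => x Bx; apply: AB0; right.
  move=> x; rewrite /B /= in_itv /= => Bx; rewrite lee_fin.
  rewrite (@weight_cell _ s (N + K)%N); first by apply: ud => //; exact: leq_addr.
  by move: Bx => /andP[h1 ->]; rewrite andbT; lra.
have foo K : ((K%:R * (d / 2))%:E <= \int[mu]_(x in `]0%R, +oo[) f x)%E.
  apply: (le_trans (step K)); apply: ge0_subset_integral => //.
  by move=> x /=; rewrite !in_itv /= => /andP[->].
have I0 : (0 <= \int[mu]_(x in `]0%R, +oo[) f x)%E.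
  by apply: integral_ge0 => x _; exact: f0.
move=> Ioo; have Ifin : (\int[mu]_(x in `]0%R, +oo[) f x)%E \is a fin_num by rewrite ge0_fin_numE.
move: foo; rewrite -(fineK Ifin); set r := fine _ => foo.
have := foo (Num.truncn (r / (d / 2))).+1.
rewrite lee_fin -ler_pdivlMr ?divr_gt0 // leNgt.
by rewrite truncnS_gt.
Qed.
End L2.

(** * Flux and reflection coefficients of the Weyl solution *)

Section Weyl.
Variable R : realType.
Local Notation Re := complex.Re.
Local Notation Im := complex.Im.
Local Notation N := (@Normc.normc R).
Implicit Types (s : nat -> nat) (u v : R -> R[i]) (w z : R[i]).

Lemma normc_ge0 (x : R[i]) : 0 <= N x.
Proof. by case: x => a b; exact: sqrtr_ge0. Qed.

Lemma normcB (x y : R[i]) : N (x - y) <= N x + N y.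
Proof. by rewrite -(normcN y); exact: le_normcD. Qed.

Lemma normc_lowerD (x y : R[i]) : N x - N y <= N (x + y).
Proof. by rewrite lerBlDr -{1}(addrK y x); exact: normcB. Qed.

Lemma normc_sqr (x : R[i]) : N x ^+ 2 = Re x ^+ 2 + Im x ^+ 2.
Proof. by case: x => a b; rewrite sqr_sqrtr // addr_ge0 ?sqr_ge0. Qed.

Lemma normc_real (x : R) : N (x%:C) = `|x|.
Proof. by rewrite /= expr0n /= addr0 sqrtr_sqr. Qed.

Lemma nat_complexE (n : nat) : n%:R = (n%:R : R)%:C :> R[i].
Proof. by rewrite rmorph_nat. Qed.

Lemma normc_nat (n : nat) : N (n%:R : R[i]) = n%:R.
Proof. by rewrite nat_complexE normc_real normr_nat. Qed.

Lemma normc_eq0 (x : R[i]) : (N x == 0) = (x == 0).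
Proof. by apply/eqP/eqP => [/Normc.eq0_normc|->] //; rewrite Normc.normc0. Qed.

Lemma normc_natB_ge1 (p q : nat) : p != q -> 1 <= N (q%:R - p%:R).
Proof.
rewrite !nat_complexE -rmorphB normc_real; case: (ltngtP p q) => // pq _.
  by rewrite ger0_norm ?subr_ge0 ?ler_nat 1?ltnW // lerBrDr addrC natr1 ler_nat.
by rewrite ler0_norm ?subr_le0 ?ler_nat 1?ltnW // opprB lerBrDr addrC natr1 ler_nat.
Qed.

(** This is exp (- 2 w), in the form in which it comes out of the transfer
    relations. *)
Definition phase w : R[i] := cexp (- w) / cexp w.

Lemma normc_phase w : N (phase w) = expR (- 2 * Re w).
Proof.
rewrite /phase Normc.normcM Normc.normcV !normc_cexp -expRN -expRD; congr expR.
by case: (w) => x y /=; ring.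
Qed.

(** The explicit form of a solution on every cell.  It is linear in (u, v) and
    free of exceptional null sets, so it passes at once from the Dirichlet and
    Neumann solutions to the Weyl solution. *)
Definition cell_solution s w u v := forall (n : nat) (e : bool) x,
  n%:R <= x <= n.+1%:R ->
  u x + (-1) ^+ e / ((s n)%:R * w) * v x =
  cexp ((-1) ^+ e * w * (x - n%:R)%:C) *
    (u n%:R + (-1) ^+ e / ((s n)%:R * w) * v n%:R).

Lemma cell_solution_comb s w u1 v1 u2 v2 (c : R[i]) :
  cell_solution s w u1 v1 -> cell_solution s w u2 v2 ->
  cell_solution s w (fun x => u1 x + c * u2 x) (fun x => v1 x + c * v2 x).
Proof.
move=> h1 h2 n e x nx /=.
have := h1 n e x nx; have := h2 n e x nx; move: (_ / _) (cexp _) => k X e2 e1.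
transitivity ((u1 x + k * v1 x) + c * (u2 x + k * v2 x)); first by ring.
by rewrite e1 e2; ring.
Qed.

(** Twice the coefficients of exp (w (x - n)) and exp (- w (x - n)) on the n-th
    cell. *)
Definition growing s w u v (n : nat) : R[i] := u n%:R + ((s n)%:R * w)^-1 * v n%:R.
Definition decaying s w u v (n : nat) : R[i] := u n%:R - ((s n)%:R * w)^-1 * v n%:R.

Section Fixed.
Variables (s : nat -> nat) (w : R[i]) (u v : R -> R[i]).
Hypothesis s0 : forall n, (0 < s n)%N.
Hypothesis w0 : 0 < Re w.
Hypothesis uv : cell_solution s w u v.
Notation a := (growing s w u v).
Notation b := (decaying s w u v).

Let wn0 : w != 0.
Proof. by apply: contraTneq w0 => ->; rewrite ltxx. Qed.

Let sn0 n : (s n)%:R != 0 :> R[i].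
Proof. by rewrite pnatr_eq0 -lt0n. Qed.

Lemma cell_growing n x : n%:R <= x <= n.+1%:R ->
  u x + ((s n)%:R * w)^-1 * v x = cexp (w * (x - n%:R)%:C) * a n.
Proof. by move=> /(uv false); rewrite expr0 !mul1r. Qed.

Lemma cell_decaying n x : n%:R <= x <= n.+1%:R ->
  u x - ((s n)%:R * w)^-1 * v x = cexp (- w * (x - n%:R)%:C) * b n.
Proof. by move=> /(uv true); rewrite expr1 !mulN1r !mulNr. Qed.

(** Here u and v are continuous at n + 1, and passing from one cell to the next
    only replaces s n by s (n+1) in the definition of the coefficients. *)
Lemma transfer_growing n : 2 * (s n)%:R * cexp w * a n =
  ((s n)%:R + (s n.+1)%:R) * a n.+1 + ((s n)%:R - (s n.+1)%:R) * b n.+1.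
Proof.
have h : n%:R <= (n.+1%:R : R) <= n.+1%:R by rewrite lexx andbT ler_nat.
have := cell_growing h; rewrite -natr1 addrAC subrr add0r mulr1 natr1.
rewrite -mulrA => <-; rewrite /growing /decaying.
by field; rewrite wn0 !sn0.
Qed.

Lemma transfer_decaying n : 2 * (s n)%:R * cexp (- w) * b n =
  ((s n)%:R - (s n.+1)%:R) * a n.+1 + ((s n)%:R + (s n.+1)%:R) * b n.+1.
Proof.
have h : n%:R <= (n.+1%:R : R) <= n.+1%:R by rewrite lexx andbT ler_nat.
have := cell_decaying h; rewrite -natr1 addrAC subrr add0r mulr1 natr1.
rewrite -mulrA => <-; rewrite /growing /decaying.
by field; rewrite wn0 !sn0.
Qed.

(** Up to a positive factor this is Re (u conj (v / w)) at n, a quantity without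
    jumps. *)
Definition flux n : R := (s n)%:R * (N (a n) ^+ 2 - N (b n) ^+ 2).

(** The matrix of a jump preserves the indefinite form |x|^2 - |y|^2 up to scale. *)
Lemma normc_sqr_mix (p q : nat) (x y : R[i]) :
  N ((p%:R + q%:R) * x + (p%:R - q%:R) * y) ^+ 2 -
  N ((p%:R - q%:R) * x + (p%:R + q%:R) * y) ^+ 2 =
  4 * p%:R * q%:R * (N x ^+ 2 - N y ^+ 2).
Proof.
rewrite !normc_sqr !nat_complexE.
by case: x y => [x1 x2] [y1 y2] /=; ring.
Qed.

Lemma fluxS n : flux n.+1 = (s n)%:R *
  ((expR (Re w) * N (a n)) ^+ 2 - (expR (- Re w) * N (b n)) ^+ 2).
Proof.
have sR : (s n)%:R != 0 :> R by rewrite pnatr_eq0 -lt0n.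
have := normc_sqr_mix (s n) (s n.+1) (a n.+1) (b n.+1).
rewrite -transfer_growing -transfer_decaying !Normc.normcM !normc_nat !normc_cexp.
have -> : Re (- w) = - Re w by case: (w).
move=> h; apply: (@mulfI _ (4 * (s n)%:R)).
  by rewrite mulf_neq0 // pnatr_eq0.
by rewrite /flux mulrA -h; ring.
Qed.

Lemma flux_mono n m : (n <= m)%N -> flux n <= flux m.
Proof.
elim: m => [|m IH]; first by rewrite leqn0 => /eqP ->.
rewrite leq_eqVlt ltnS => /predU1P[->//|/IH /le_trans]; apply.
rewrite fluxS /flux ler_pM2l ?ltr0n //; apply: lerB.
  rewrite ler_sqr ?nnegrE ?mulr_ge0 ?normc_ge0 ?expR_ge0 //.
  by rewrite ler_peMl ?normc_ge0 // -expR0 ler_expR ltW.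
rewrite ler_sqr ?nnegrE ?mulr_ge0 ?normc_ge0 ?expR_ge0 //.
by rewrite ler_piMl ?normc_ge0 // -expR0 ler_expR oppr_le0 ltW.
Qed.

(** If the flux is positive at n, it stays above that value, so the growing part
    dominates on every later cell.  At distance at least 1/2 from the left
    endpoint the growing exponential is at least exp (Re w / 2) and the decaying
    one at most 1, which bounds |u| from below. *)
Lemma flux_le0 n : in_L2 s u -> flux n <= 0.
Proof.
move=> uL2; rewrite leNgt; apply/negP => Qn.
pose g := (expR (Re w / 2) - 1) / 2.
have g0 : 0 < g.
  by rewrite divr_gt0 // subr_gt0 -expR0 ltr_expR divr_gt0.
apply: (@in_L2_not_bounded_below _ _ _ n (flux n * g ^+ 2) uL2).
  by rewrite mulr_gt0 // exprn_gt0.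
move=> j x nj /andP[jx xj].
have Qj := flux_mono nj.
have Qj0 := lt_le_trans Qn Qj.
have sj : 0 < (s j)%:R :> R by rewrite ltr0n.
have abj : N (b j) <= N (a j).
  rewrite -ler_sqr ?nnegrE ?normc_ge0 // -subr_ge0.
  by move: Qj0; rewrite /flux pmulr_rgt0 // => /ltW.
have aj : flux n <= (s j)%:R * N (a j) ^+ 2.
  apply: (le_trans Qj); rewrite /flux ler_pM2l // gerBl; exact: sqr_ge0.
have xjj : j%:R <= x <= j.+1%:R by apply/andP; split; lra.
have ux : 2 * u x = cexp (w * (x - j%:R)%:C) * a j + cexp (- w * (x - j%:R)%:C) * b j.
  by rewrite -cell_growing // -cell_decaying //; ring.
have : g * N (a j) <= N (u x).
  suff : 2 * (g * N (a j)) <= N (2 * u x).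
    by rewrite Normc.normcM (normc_nat 2); lra.
  rewrite ux; apply: le_trans (normc_lowerD _ _); rewrite !Normc.normcM !normc_cexp.
  have -> : Re (w * (x - j%:R)%:C) = Re w * (x - j%:R) by case: (w) => ? ? /=; ring.
  have -> : Re (- w * (x - j%:R)%:C) = - (Re w * (x - j%:R)) by case: (w) => ? ? /=; ring.
  have e1 : expR (Re w / 2) <= expR (Re w * (x - j%:R)).
    by rewrite ler_expR ler_pM2l //; lra.
  have e2 : expR (- (Re w * (x - j%:R))) <= 1.
    by rewrite -[leRHS]expR0 ler_expR oppr_le0 mulr_ge0 ?(ltW w0) //; lra.
  have b0 := normc_ge0 (b j).
  have a0 := normc_ge0 (a j).
  have := ler_wpM2r a0 e1; have := ler_wpM2r b0 e2; rewrite /g; lra.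
move=> gu; apply: (@le_trans _ _ ((g * N (a j)) ^+ 2 * (s j)%:R)).
  have -> : (g * N (a j)) ^+ 2 * (s j)%:R = (s j)%:R * N (a j) ^+ 2 * g ^+ 2 by ring.
  by apply: ler_wpM2r => //; exact: sqr_ge0.
rewrite ler_pM2r //; apply: lerXn2r; rewrite ?nnegrE ?normc_ge0 //.
by apply: mulr_ge0; [exact: ltW|exact: normc_ge0].
Qed.

Lemma growing_le_decaying n : in_L2 s u -> N (a n) <= N (b n).
Proof.
move=> /(flux_le0 n); rewrite /flux pmulr_rle0 ?ltr0n // subr_le0.
by rewrite ler_sqr ?nnegrE ?normc_ge0.
Qed.

(** If b vanishes at some n, then so does a, and transfer back to 0 gives
    u 0 = 0. *)
Lemma decaying_neq0 n : in_L2 s u -> u 0 != 0 -> b n != 0.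
Proof.
move=> uL2 u0; elim: n => [|n IH].
  apply: contra u0 => /eqP b0; have := growing_le_decaying 0 uL2; rewrite b0 Normc.normc0.
  rewrite le_eqVlt ltNge normc_ge0 orbF normc_eq0 => /eqP a0.
  have : 2 * u 0 = a 0%N + b 0%N by rewrite /growing /decaying; ring.
  by rewrite a0 b0 addr0 => /eqP; rewrite mulf_eq0 pnatr_eq0.
apply: contra IH => /eqP b0; have := growing_le_decaying n.+1 uL2; rewrite b0 Normc.normc0.
rewrite le_eqVlt ltNge normc_ge0 orbF normc_eq0 => /eqP a0.
have := transfer_decaying n; rewrite a0 b0 !mulr0 addr0 => /eqP.
by rewrite !mulf_eq0 pnatr_eq0 (negPf (sn0 n)) (negPf (cexp_neq0 _)).
Qed.

End Fixed.

(** The Moebius recursion for r n = a n / b n, cleared of denominators. *)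
Definition reflection s w (r : nat -> R[i]) := forall n,
  N (r n) <= 1 /\
  ((s n)%:R + (s n.+1)%:R + ((s n)%:R - (s n.+1)%:R) * r n.+1) * r n =
  phase w * (((s n)%:R + (s n.+1)%:R) * r n.+1 + ((s n)%:R - (s n.+1)%:R)).

Lemma weyl_reflection s (m : R[i] -> R[i]) z w : (forall n, 0 < s n)%N ->
  is_weyl_titchmarsh s m -> Im z != 0 -> w ^+ 2 = - z -> 0 < Re w ->
  exists2 r, reflection s w r & m z * (1 + r 0%N) = (s 0)%:R * w * (r 0%N - 1).
Proof.
move=> s0 ms z0 wz w0.
have wn0 : w != 0 by apply: contraTneq w0 => ->; rewrite ltxx.
have [phi [th [[v1 [sol1 p0 v10]] [v2 [sol2 t0 v20]] L2]]] := ms z z0.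
have c1 : cell_solution s w phi v1 by move=> n e; exact: solution_cell sol1 wz wn0 (s0 n).
have c2 : cell_solution s w th v2 by move=> n e; exact: solution_cell sol2 wz wn0 (s0 n).
have c := cell_solution_comb (m z) c2 c1.
set u := (fun x => th x + _) in c L2; set v := (fun x => _) in c.
have u0 : u 0 = 1 by rewrite /u p0 t0 mulr0 addr0.
have v0 : v 0 = m z by rewrite /v v10 v20 add0r mulr1.
pose a := growing s w u v; pose b := decaying s w u v.
have b0 n : b n != 0 by apply: decaying_neq0 => //; rewrite u0 oner_neq0.
have sn0 n : (s n)%:R != 0 :> R[i] by rewrite pnatr_eq0 -lt0n.
exists (fun n => a n / b n); last first.
  apply: (mulIf (b0 0%N)).
  transitivity (m z * (a 0%N + b 0%N)); first by field; exact: b0.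
  transitivity ((s 0)%:R * w * (a 0%N - b 0%N)); last by field; exact: b0.
  by rewrite /a /b /growing /decaying u0 v0; field; rewrite wn0 sn0.
move=> n; split.
  rewrite Normc.normcM Normc.normcV ler_pdivrMr ?mul1r; first exact: growing_le_decaying.
  by rewrite lt_neqAle normc_ge0 eq_sym normc_eq0 b0.
have tin := transfer_growing s0 w0 c n; have tout := transfer_decaying s0 w0 c n.
rewrite -/a -/b in tin tout.
apply: (mulIf (b0 n.+1)); apply: (mulIf (b0 n)); apply: (mulIf (cexp_neq0 w)).
transitivity ((((s n)%:R - (s n.+1)%:R) * a n.+1 + ((s n)%:R + (s n.+1)%:R) * b n.+1) *
  a n * cexp w); first by field; rewrite !b0.
rewrite -tout /phase.
transitivity (cexp (- w) * b n * (((s n)%:R + (s n.+1)%:R) * a n.+1 +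
  ((s n)%:R - (s n.+1)%:R) * b n.+1)); last by field; rewrite !b0 cexp_neq0.
by rewrite -tin; ring.
Qed.

End Weyl.

(** * One-step estimates for reflection coefficients *)

Section Estimates.
Variable R : realType.
Local Notation Re := complex.Re.
Local Notation Im := complex.Im.
Local Notation N := (@Normc.normc R).
Implicit Types (s st : nat -> nat) (w x y E : R[i]) (p q M : nat).

(** Numerator and denominator of the Moebius map (rho + x) / (1 + rho x), with
    rho = (p - q) / (p + q). *)
Definition jump_den p q x : R[i] := p%:R + q%:R + (p%:R - q%:R) * x.
Definition jump_num p q x : R[i] := (p%:R + q%:R) * x + (p%:R - q%:R).

Lemma jump_den_bounds p q M x : (0 < p <= M)%N -> (0 < q <= M)%N -> N x <= 1 ->
  2 <= N (jump_den p q x) <= 2 * M%:R.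
Proof.
move=> /andP[p0 pM] /andP[q0 qM] x1.
have p1 : 1 <= p%:R :> R by rewrite ler1n.
have q1 : 1 <= q%:R :> R by rewrite ler1n.
have pMR : p%:R <= M%:R :> R by rewrite ler_nat.
have qMR : q%:R <= M%:R :> R by rewrite ler_nat.
have Npq : N (p%:R + q%:R : R[i]) = p%:R + q%:R by rewrite -natrD normc_nat natrD.
have Nmq : N (p%:R - q%:R : R[i]) = `|p%:R - q%:R| by rewrite !nat_complexE -rmorphB normc_real.
have x0 := normc_ge0 x.
have h : `|p%:R - q%:R| * N x <= `|p%:R - q%:R| :> R by rewrite ler_piMr.
have h1 := normc_lowerD (p%:R + q%:R) ((p%:R - q%:R) * x).
have h2 := le_normcD (p%:R + q%:R) ((p%:R - q%:R) * x).
rewrite Normc.normcM Npq Nmq in h1 h2.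
rewrite /jump_den; have [pq|pq] := leP (p%:R : R) q%:R.
  rewrite ler0_norm ?subr_le0 // in h h1 h2; apply/andP; split; lra.
rewrite gtr0_norm ?subr_gt0 // in h h1 h2; apply/andP; split; lra.
Qed.

(** The Moebius map preserves the unit disc. *)
Lemma jump_num_le_den p q x : N x <= 1 -> N (jump_num p q x) <= N (jump_den p q x).
Proof.
move=> x1; rewrite -ler_sqr ?nnegrE ?normc_ge0 // -subr_ge0.
have := normc_sqr_mix p q (1 : R[i]) x; rewrite !mulr1 Normc.normc1 expr1n.
rewrite /jump_den /jump_num [(_ - _) + (_ + _) * x]addrC => ->.
by rewrite mulr_ge0 // subr_ge0 expr_le1 ?normc_ge0.
Qed.

Section Step.
Variables (p M : nat) (E : R[i]).
Hypothesis pM : (0 < p <= M)%N.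

Lemma step_small q x y : (0 < q <= M)%N -> N x <= 1 ->
  jump_den p q x * y = E * jump_num p q x -> N y <= N E.
Proof.
move=> qM x1 /(congr1 N); rewrite !Normc.normcM => h.
have /andP[d2 _] := jump_den_bounds pM qM x1.
have d0 : 0 < N (jump_den p q x) by lra.
rewrite -(ler_pM2l d0) h mulrC ler_wpM2r ?normc_ge0 //; exact: jump_num_le_den.
Qed.

(** The difference y1 - y2 is E (x1 - x2) times 4 p q over the product of the two
    denominators, and this factor lies between M^-2 and M^2. *)
Lemma step_diff q x1 x2 y1 y2 : (0 < q <= M)%N -> N x1 <= 1 -> N x2 <= 1 ->
  jump_den p q x1 * y1 = E * jump_num p q x1 -> jump_den p q x2 * y2 = E * jump_num p q x2 ->
  N E * N (x1 - x2) <= M%:R ^+ 2 * N (y1 - y2) /\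
  N (y1 - y2) <= M%:R ^+ 2 * (N E * N (x1 - x2)).
Proof.
move=> qM h1 h2 e1 e2.
have /andP[d1 D1] := jump_den_bounds pM qM h1.
have /andP[d2 D2] := jump_den_bounds pM qM h2.
have [p0 pM'] := andP pM; have [q0 qM'] := andP qM.
have key : jump_den p q x1 * jump_den p q x2 * (y1 - y2) = (4 * p * q)%:R * (E * (x1 - x2)).
  transitivity (jump_den p q x2 * (jump_den p q x1 * y1) - jump_den p q x1 * (jump_den p q x2 * y2)).
    by ring.
  by rewrite e1 e2 /jump_den /jump_num !natrM; ring.
move/(congr1 N): key; rewrite !Normc.normcM normc_nat !natrM.
have := normc_ge0 (y1 - y2); have : 0 <= N E * N (x1 - x2) by rewrite mulr_ge0 ?normc_ge0.
move: d1 d2 D1 D2; move: (N (jump_den _ _ x1)) (N (jump_den _ _ x2)) (N (y1 - y2)) (N E * _).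
move=> A B Y X A2 B2 AM BM X0 Y0 key.
have M1 : 1 <= M%:R :> R by rewrite ler1n (leq_trans p0).
have AB : 4 <= A * B <= 4 * M%:R ^+ 2.
  by apply/andP; split; [nra|rewrite expr2; nra].
have pq : (1 : R) <= (p%:R * q%:R : R) <= (M%:R ^+ 2 : R).
  apply/andP; split; first by rewrite -natrM ler1n muln_gt0 p0 q0.
  by rewrite expr2; apply: ler_pM => //; rewrite ler_nat.
have {}key : A * B * Y = 4 * (p%:R * q%:R) * X by rewrite key; ring.
move: AB pq key; move: (A * B) (p%:R * q%:R) (M%:R ^+ 2) => C P K /andP[C1 C2] /andP[P1 P2] key.
split; nra.
Qed.

(** Up to errors quadratic in E, yi is E (p - qi) / (p + qi), and this quotient
    depends injectively on qi. *)
Lemma step_split q1 q2 x1 x2 y1 y2 : (0 < q1 <= M)%N -> (0 < q2 <= M)%N -> q1 != q2 ->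
  N x1 <= N E -> N x2 <= N E -> 8 * M%:R ^+ 3 * N E <= 1 ->
  jump_den p q1 x1 * y1 = E * jump_num p q1 x1 -> jump_den p q2 x2 * y2 = E * jump_num p q2 x2 ->
  N E <= 4 * M%:R ^+ 2 * N (y1 - y2).
Proof.
move=> qM1 qM2 q12 h1 h2 ME e1 e2.
have M1 : 1 <= M%:R :> R by rewrite ler1n (leq_trans _ (andP pM).2) // (andP pM).1.
have E0 := normc_ge0 E.
have M3 : 1 <= M%:R ^+ 3 :> R by apply: exprn_ege1.
have E1 : N E <= 1 by nra.
have err q x y : (0 < q <= M)%N -> N x <= N E -> jump_den p q x * y = E * jump_num p q x ->
    N ((p%:R + q%:R) * y - E * (p%:R - q%:R)) <= 2 * M%:R ^+ 2 * N E ^+ 2.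
  move=> qM h e; have /andP[d D] := jump_den_bounds pM qM (le_trans h E1).
  have : jump_den p q x * ((p%:R + q%:R) * y - E * (p%:R - q%:R)) = (4 * p * q)%:R * (E * x).
    transitivity ((p%:R + q%:R) * (jump_den p q x * y) - jump_den p q x * (E * (p%:R - q%:R))).
      by ring.
    by rewrite e /jump_den /jump_num !natrM; ring.
  move/(congr1 N); rewrite !Normc.normcM normc_nat !natrM.
  have pq : (1 : R) <= (p%:R * q%:R : R) <= (M%:R ^+ 2 : R).
    have [p0 pM'] := andP pM; have [q0 qM'] := andP qM.
    apply/andP; split; first by rewrite -natrM ler1n muln_gt0 p0 q0.
    by rewrite expr2; apply: ler_pM => //; rewrite ler_nat.
  have Ex : N E * N x <= N E ^+ 2 by rewrite expr2 ler_wpM2l.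
  have Ex0 : 0 <= N E * N x by rewrite mulr_ge0 ?normc_ge0.
  have Y0 := normc_ge0 ((p%:R + q%:R) * y - E * (p%:R - q%:R)).
  move: pq d Y0 Ex Ex0; move: (N (jump_den _ _ _)) (N (_ - _)) (N E * N x) (N E ^+ 2) (M%:R ^+ 2).
  move=> A Y X X' K /andP[P1 P2] A2 Y0 XX X0 key.
  have {}key : A * Y = 4 * (p%:R * q%:R) * X by rewrite key; ring.
  have h3 : 2 * Y <= A * Y by rewrite ler_wpM2r.
  have h4 : (p%:R * q%:R) * X <= K * X' by apply: ler_pM => //; lra.
  lra.
have r1 := err _ _ _ qM1 h1 e1; have r2 := err _ _ _ qM2 h2 e2.
set a1 := _ - _ in r1; set a2 := _ - _ in r2.
have key : (p + q1)%:R * (p + q2)%:R * (y1 - y2) + ((p + q1)%:R * a2 - (p + q2)%:R * a1) =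
    2 * p%:R * (q2%:R - q1%:R) * E.
  by rewrite /a1 /a2 !natrD; ring.
have qq := normc_natB_ge1 R q12.
have low : 2 * N E <= N (2 * p%:R * (q2%:R - q1%:R) * E).
  rewrite !Normc.normcM !normc_nat ler_wpM2r //.
  have p1 : 1 <= p%:R :> R by rewrite ler1n (andP pM).1.
  nra.
have up := le_normcD ((p + q1)%:R * (p + q2)%:R * (y1 - y2)) ((p + q1)%:R * a2 - (p + q2)%:R * a1).
have up2 := normcB ((p + q1)%:R * a2) ((p + q2)%:R * a1).
rewrite key in up; rewrite !Normc.normcM !normc_nat in low up up2.
have b1 : (p + q1)%:R <= 2 * M%:R :> R.
  by rewrite -(natrM _ 2) ler_nat mul2n -addnn leq_add // ?(andP pM).2 ?(andP qM1).2.
have b2 : (p + q2)%:R <= 2 * M%:R :> R.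
  by rewrite -(natrM _ 2) ler_nat mul2n -addnn leq_add // ?(andP pM).2 ?(andP qM2).2.
have c1 : (p + q1)%:R * (p + q2)%:R * N (y1 - y2) <= 4 * M%:R ^+ 2 * N (y1 - y2).
  rewrite ler_wpM2r ?normc_ge0 //.
  have -> : 4 * M%:R ^+ 2 = (2 * M%:R) * (2 * M%:R) :> R by ring.
  by apply: ler_pM.
have c2 : (p + q1)%:R * N a2 <= 4 * M%:R ^+ 3 * N E ^+ 2.
  have -> : 4 * M%:R ^+ 3 * N E ^+ 2 = (2 * M%:R) * (2 * M%:R ^+ 2 * N E ^+ 2) by ring.
  by apply: ler_pM => //; exact: normc_ge0.
have c3 : (p + q2)%:R * N a1 <= 4 * M%:R ^+ 3 * N E ^+ 2.
  have -> : 4 * M%:R ^+ 3 * N E ^+ 2 = (2 * M%:R) * (2 * M%:R ^+ 2 * N E ^+ 2) by ring.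
  by apply: ler_pM => //; exact: normc_ge0.
have c4 : 8 * M%:R ^+ 3 * N E ^+ 2 <= N E.
  have := ler_wpM2r E0 ME; rewrite mul1r; apply: le_trans.
  by rewrite expr2 mulrA.
lra.
Qed.

End Step.

Lemma normc_1D x : N x <= 2^-1 -> 2^-1 <= N (1 + x) <= 2.
Proof.
move=> x2; have := le_normcD 1 x; have := normc_lowerD 1 x; rewrite Normc.normc1.
by move=> *; apply/andP; split; lra.
Qed.

Lemma m_diff_same p M w x1 x2 m1 m2 : (0 < p <= M)%N -> N x1 <= 2^-1 -> N x2 <= 2^-1 ->
  m1 * (1 + x1) = p%:R * w * (x1 - 1) -> m2 * (1 + x2) = p%:R * w * (x2 - 1) ->
  N w * N (x1 - x2) <= 2 * N (m1 - m2) /\ N (m1 - m2) <= 8 * M%:R * (N w * N (x1 - x2)).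
Proof.
move=> /andP[p0 pM] h1 h2 e1 e2.
have : (1 + x1) * (1 + x2) * (m1 - m2) = 2 * p%:R * (w * (x1 - x2)).
  transitivity ((1 + x2) * (m1 * (1 + x1)) - (1 + x1) * (m2 * (1 + x2))); first by ring.
  by rewrite e1 e2; ring.
move/(congr1 N); rewrite !Normc.normcM !normc_nat.
have := normc_ge0 (m1 - m2); have : 0 <= N w * N (x1 - x2) by rewrite mulr_ge0 ?normc_ge0.
move: (normc_1D h1) (normc_1D h2); move: (N (1 + x1)) (N (1 + x2)) (N (m1 - m2)) (N w * _).
move=> A B Y X /andP[A1 A2] /andP[B1 B2] X0 Y0 key.
have p1 : 1 <= p%:R :> R by rewrite ler1n.
have pMR : p%:R <= M%:R :> R by rewrite ler_nat.
have AB : 4^-1 <= A * B <= 4 by apply/andP; split; nra.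
move: AB key; move: (A * B) => C /andP[C1 C2] key.
have k1 : 4^-1 * Y <= C * Y by rewrite ler_wpM2r.
have k2 : C * Y <= 4 * Y by rewrite ler_wpM2r.
have k3 : X <= p%:R * X by rewrite ler_peMl.
have k4 : p%:R * X <= M%:R * X by rewrite ler_wpM2r.
split; lra.
Qed.

(** To leading order mi is - pi w. *)
Lemma m_diff_split p1 p2 M w x1 x2 m1 m2 : (0 < p1 <= M)%N -> (0 < p2 <= M)%N -> p1 != p2 ->
  N x1 <= (16 * M%:R)^-1 -> N x2 <= (16 * M%:R)^-1 ->
  m1 * (1 + x1) = p1%:R * w * (x1 - 1) -> m2 * (1 + x2) = p2%:R * w * (x2 - 1) ->
  N w <= 2 * N (m1 - m2).
Proof.
move=> pM1 pM2 p12 h1 h2 e1 e2.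
have M1 : 1 <= M%:R :> R by rewrite ler1n (leq_trans _ (andP pM1).2) // (andP pM1).1.
have small x : N x <= (16 * M%:R)^-1 -> N x <= 2^-1.
  move/le_trans; apply; rewrite lef_pV2 ?posrE //; lra.
have w0 := normc_ge0 w.
have err p x m : (0 < p <= M)%N -> N x <= (16 * M%:R)^-1 ->
    m * (1 + x) = p%:R * w * (x - 1) -> N (m + p%:R * w) <= 4^-1 * N w.
  move=> /andP[p0 pM] h e; have /andP[d _] := normc_1D (small _ h).
  have : (1 + x) * (m + p%:R * w) = 2 * p%:R * (w * x).
    transitivity (m * (1 + x) + (1 + x) * (p%:R * w)); first by ring.
    by rewrite e; ring.
  move/(congr1 N); rewrite !Normc.normcM !normc_nat => key.
  have px : p%:R * N x <= 16^-1.
    have pMR : p%:R <= M%:R :> R by rewrite ler_nat.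
    apply: (@le_trans _ _ (M%:R * (16 * M%:R)^-1)).
      by apply: ler_pM => //; exact: normc_ge0.
    by rewrite invfM mulrCA divff ?mulr1 // gt_eqF //; lra.
  have k1 := ler_wpM2r w0 px.
  have k2 := ler_wpM2r (normc_ge0 (m + p%:R * w)) d.
  lra.
have r1 := err _ _ _ pM1 h1 e1; have r2 := err _ _ _ pM2 h2 e2.
have qq := normc_natB_ge1 R p12.
have low : N w <= N ((p2%:R - p1%:R) * w) by rewrite Normc.normcM ler_peMl.
have e : (p2%:R - p1%:R) * w = (m1 - m2) + ((m2 + p2%:R * w) - (m1 + p1%:R * w)) by ring.
have := le_normcD (m1 - m2) ((m2 + p2%:R * w) - (m1 + p1%:R * w)); rewrite -e => k1.
have := normcB (m2 + p2%:R * w) (m1 + p1%:R * w) => k2.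
lra.
Qed.

End Estimates.

(** * Comparison of two Weyl functions at a fixed point *)

Section Comparison.
Variable R : realType.
Local Notation Re := complex.Re.
Local Notation Im := complex.Im.
Local Notation N := (@Normc.normc R).

Lemma reflection_small (M : nat) (s : nat -> nat) (w : R[i]) (r : nat -> R[i]) (n : nat) :
  (forall n, (0 < s n <= M)%N) -> reflection s w r -> N (r n) <= N (phase w).
Proof.
by move=> sM sr; have [r1 _] := sr n.+1; have [_] := sr n; exact: (step_small (sM n) (sM n.+1)) r1.
Qed.

Section Two.
Variables (M : nat) (s st : nat -> nat).
Hypothesis sM : forall n, (0 < s n <= M)%N.
Hypothesis stM : forall n, (0 < st n <= M)%N.
Variables (w : R[i]) (r rt : nat -> R[i]) (m mt : R[i]).
Hypothesis sr : reflection s w r.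
Hypothesis str : reflection st w rt.
Hypothesis mr : m * (1 + r 0%N) = (s 0)%:R * w * (r 0%N - 1).
Hypothesis mtr : mt * (1 + rt 0%N) = (st 0)%:R * w * (rt 0%N - 1).
Notation e := (N (phase w)).

Lemma reflection_diff j : (forall i, (i <= j)%N -> s i = st i) ->
  e ^+ j * N (r j - rt j) <= (M%:R ^+ 2) ^+ j * N (r 0%N - rt 0%N) /\
  N (r 0%N - rt 0%N) <= (M%:R ^+ 2) ^+ j * (e ^+ j * N (r j - rt j)).
Proof.
elim: j => [|j IH] sst; first by rewrite !expr0 !mul1r.
have [|l u] := IH; first by move=> i ij; apply: sst; exact: leqW.
have [r1 _] := sr j.+1; have [_ r2] := sr j.
have [t1 _] := str j.+1; have [_ t2] := str j.
rewrite -!sst // in t2.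
have [l' u'] := step_diff (sM j) (sM j.+1) r1 t1 r2 t2.
have ej : 0 <= e ^+ j by rewrite exprn_ge0 ?normc_ge0.
have Mj : 0 <= (M%:R ^+ 2) ^+ j :> R by rewrite !exprn_ge0.
have M2 : 0 <= M%:R ^+ 2 :> R by rewrite exprn_ge0.
split.
  apply: (@le_trans _ _ (M%:R ^+ 2 * (e ^+ j * N (r j - rt j)))).
    rewrite [e ^+ j.+1]exprSr -mulrA [leRHS]mulrCA; exact: ler_wpM2l.
  by rewrite [(M%:R ^+ 2) ^+ _]exprS -mulrA; exact: ler_wpM2l.
apply: (le_trans u); rewrite [X in _ <= X * _]exprSr -mulrA; apply: ler_wpM2l => //.
by rewrite [e ^+ j.+1]exprSr -mulrA [leRHS]mulrCA; exact: ler_wpM2l.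
Qed.

Lemma m_diff_upper k : (forall i, (i <= k)%N -> s i = st i) -> e <= 2^-1 ->
  N (m - mt) <= 16 * M%:R * (M%:R ^+ 2) ^+ k * (N w * e ^+ k.+1).
Proof.
move=> sst e2.
have [_ u] := reflection_diff sst.
have mtr' := mtr; rewrite -sst // in mtr'.
have [_ mu] := m_diff_same (sM 0) (le_trans (reflection_small 0 sM sr) e2)
  (le_trans (reflection_small 0 stM str) e2) mr mtr'.
have rk : N (r k - rt k) <= 2 * e.
  by have := normcB (r k) (rt k); have := reflection_small k sM sr; have := reflection_small k stM str; lra.
have -> : 16 * M%:R * (M%:R ^+ 2) ^+ k * (N w * e ^+ k.+1) =
   8 * M%:R * (N w * ((M%:R ^+ 2) ^+ k * (e ^+ k * (2 * e)))).
  by rewrite [e ^+ k.+1]exprSr; ring.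
apply: (le_trans mu); apply: ler_wpM2l; first by rewrite mulr_ge0.
apply: ler_wpM2l; first exact: normc_ge0.
apply: (le_trans u); apply: ler_wpM2l; first by rewrite !exprn_ge0.
by apply: ler_wpM2l => //; rewrite exprn_ge0 ?normc_ge0.
Qed.

(** For j = 0 the Weyl functions already differ to leading order.  For positive j
    the branching step j - 1 creates a difference comparable to |E|, which the j - 1
    earlier common steps carry back to 0. *)
Lemma m_diff_lower j : (forall i, (i < j)%N -> s i = st i) -> s j != st j ->
  16 * M%:R ^+ 3 * e <= 1 -> e ^+ j * N w <= 8 * (M%:R ^+ 2) ^+ j * N (m - mt).
Proof.
move=> sst sj Me.
have M1 : 1 <= M%:R :> R by have /andP[h1 h2] := sM 0; rewrite ler1n (leq_trans h1).
have e0 : 0 <= e by exact: normc_ge0.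
have M3 : M%:R <= M%:R ^+ 3 :> R by rewrite ler_eXnr.
have esmall : e <= (16 * M%:R)^-1.
  rewrite -[leRHS]mul1r ler_pdivlMr; last by rewrite mulr_gt0 // (lt_le_trans ltr01).
  by apply: le_trans Me; rewrite mulrC ler_wpM2r // ler_pM2l.
have e2 : e <= 2^-1.
  by apply: (le_trans esmall); rewrite lef_pV2 ?posrE //; lra.
case: j sst sj => [_ s0|j sst sj].
  rewrite !expr0 mul1r mulr1.
  have := m_diff_split (sM 0) (stM 0) s0 (le_trans (reflection_small 0 sM sr) esmall)
    (le_trans (reflection_small 0 stM str) esmall) mr mtr.
  by have := normc_ge0 (m - mt); lra.
have mtr' := mtr; rewrite -sst // in mtr'.
have [mu _] := m_diff_same (sM 0) (le_trans (reflection_small 0 sM sr) e2)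
  (le_trans (reflection_small 0 stM str) e2) mr mtr'.
have [//|l _] := @reflection_diff j.
have [_ r2] := sr j; have [_ t2] := str j; rewrite -(sst j) // in t2.
have Me8 : 8 * M%:R ^+ 3 * e <= 1.
  by apply: le_trans Me; rewrite ler_wpM2r // ler_wpM2r ?exprn_ge0 // ler_nat.
have spl := step_split (sM j) (sM j.+1) (stM j.+1) sj (reflection_small j.+1 sM sr)
  (reflection_small j.+1 stM str) Me8 r2 t2.
apply: (@le_trans _ _ (4 * M%:R ^+ 2 * (e ^+ j * N (r j - rt j)) * N w)).
  apply: ler_wpM2r; first exact: normc_ge0.
  rewrite [e ^+ j.+1]exprSr [leRHS]mulrCA; apply: ler_wpM2l => //; exact: exprn_ge0.
apply: (@le_trans _ _ (4 * M%:R ^+ 2 * ((M%:R ^+ 2) ^+ j * N (r 0%N - rt 0%N)) * N w)).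
  apply: ler_wpM2r; first exact: normc_ge0.
  by apply: ler_wpM2l => //; rewrite mulr_ge0 ?exprn_ge0.
have -> : 4 * M%:R ^+ 2 * ((M%:R ^+ 2) ^+ j * N (r 0%N - rt 0%N)) * N w =
  (M%:R ^+ 2) ^+ j.+1 * 4 * (N w * N (r 0%N - rt 0%N)) by rewrite [_ ^+ j.+1]exprSr; ring.
have -> : 8 * (M%:R ^+ 2) ^+ j.+1 * N (m - mt) =
  (M%:R ^+ 2) ^+ j.+1 * 4 * (2 * N (m - mt)) by ring.
by apply: ler_wpM2l => //; rewrite mulr_ge0 ?exprn_ge0.
Qed.

End Two.

Section Ray.
Variable al : R.
Hypothesis al_pi : - pi < al < pi.
Hypothesis al0 : al != 0.

Lemma sin_neq0 : sin al != 0.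
Proof.
have [/andP[h1 h2]] := al_pi; case: (ltrgtP al 0) al0 => // h _.
  by rewrite -[al]opprK sinN oppr_eq0 gt_eqF // sin_gt0_pi //; apply/andP; split; lra.
by rewrite gt_eqF // sin_gt0_pi // h.
Qed.

(** This is sin (|al| / 2), the ratio of Re sqrt(-z) to the modulus of sqrt(-z) on
    the ray. *)
Definition decay := Num.sqrt ((1 - cos al) / 2).

Lemma decay_gt0 : 0 < decay.
Proof.
rewrite sqrtr_gt0 divr_gt0 // subr_gt0 lt_neqAle cos_le1 andbT.
apply: contra sin_neq0 => /eqP c1; have := cos2Dsin2 al; rewrite c1 expr1n.
by move/eqP; rewrite -subr_eq0 addrAC subrr add0r sqrf_eq0.
Qed.

Lemma normc_ray r : 0 <= r -> N (ray al r) = r.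
Proof.
move=> r0; rewrite /= !exprMn -mulrDr cos2Dsin2 mulr1 sqrtr_sqr ger0_norm //.
Qed.

Lemma normc_sqrtc_ray r : 0 <= r -> N (sqrtc (- ray al r)) = Num.sqrt r.
Proof.
move=> r0; apply/eqP; rewrite -(@eqrXn2 _ 2) ?normc_ge0 ?sqrtr_ge0 //.
set w := sqrtc _; rewrite [X in _ == X]sqr_sqrtr //.
have -> : N w ^+ 2 = N (w ^+ 2) by rewrite !expr2 Normc.normcM.
by rewrite sqr_sqrtc normcN normc_ray.
Qed.

Lemma Re_sqrtc_ray r : 0 <= r -> Re (sqrtc (- ray al r)) = decay * Num.sqrt r.
Proof.
move=> r0; rewrite /sqrtc; have := normc_ray r0; rewrite -normcN.
rewrite /= => ->.
rewrite /decay -sqrtrM; last by rewrite divr_ge0 // subr_ge0 cos_le1.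
by congr Num.sqrt; field.
Qed.

End Ray.
End Comparison.

(** * Asymptotics along a ray *)

Section Asymptotics.
Variable R : realType.
Local Notation Re := complex.Re.
Local Notation Im := complex.Im.
Local Notation N := (@Normc.normc R).

(** From exp (k x) = exp (k x / 2)^2 >= (k x / 2)^2. *)
Lemma linear_le_expR (C k e x : R) : 0 <= C -> 0 < k -> 0 < e -> 0 < x ->
  4 * C / (k ^+ 2 * e) <= x -> C * x <= e * expR (k * x).
Proof.
move=> C0 k0 e0 x0; rewrite ler_pdivrMr ?mulr_gt0 ?exprn_gt0 // => Cx.
have kx : 0 <= k * x / 2 by rewrite divr_ge0 // mulr_ge0 // ltW.
have h : (k * x / 2) ^+ 2 <= expR (k * x).
  have -> : k * x = k * x / 2 + k * x / 2 by field.
  rewrite expRD -expr2; apply: lerXn2r; rewrite ?nnegrE ?expR_ge0 //.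
    by rewrite -splitr.
  have := expR_ge1Dx (k * x / 2); rewrite -splitr; lra.
apply: (@le_trans _ _ (e * (k * x / 2) ^+ 2)); last by rewrite ler_wpM2l // ltW.
have -> : e * (k * x / 2) ^+ 2 = 4^-1 * (x * (k ^+ 2 * e)) * x by field.
by rewrite ler_wpM2r //; lra.
Qed.

Section Pair.
Variables (M : nat) (s st : nat -> nat) (m mt : R[i] -> R[i]).
Hypothesis sM : forall n, (0 < s n <= M)%N.
Hypothesis stM : forall n, (0 < st n <= M)%N.
Hypothesis hm : is_weyl_titchmarsh s m.
Hypothesis hmt : is_weyl_titchmarsh st mt.
Variable al : R.
Hypothesis al_pi : - pi < al < pi.
Hypothesis al0 : al != 0.

Let e (x : R) := expR (- 2 * (decay al * x)).
Let d (r : R) := N (m (ray al r) - mt (ray al r)).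

Lemma ray_reflections r : 0 < r ->
  let z := ray al r in let w := sqrtc (- z) in
  exists rho rhot, [/\ reflection s w rho, reflection st w rhot,
    m z * (1 + rho 0%N) = (s 0)%:R * w * (rho 0%N - 1) &
    mt z * (1 + rhot 0%N) = (st 0)%:R * w * (rhot 0%N - 1)].
Proof.
move=> r0 z w.
have z0 : Im z != 0.
  by rewrite /= mulf_eq0 negb_or gt_eqF //=; exact: sin_neq0.
have wz : w ^+ 2 = - z by rewrite sqr_sqrtc.
have w0 : 0 < Re w.
  rewrite Re_sqrtc_ray ?(ltW r0) //; apply: mulr_gt0; last by rewrite sqrtr_gt0.
  exact: decay_gt0.
have [rho h1 h2] := weyl_reflection (fun n => (andP (sM n)).1) hm z0 wz w0.
have [rhot h3 h4] := weyl_reflection (fun n => (andP (stM n)).1) hmt z0 wz w0.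
by exists rho, rhot.
Qed.

Lemma normc_phase_ray r : 0 < r -> N (phase (sqrtc (- ray al r))) = e (Num.sqrt r).
Proof. by move=> r0; rewrite normc_phase Re_sqrtc_ray ?(ltW r0). Qed.

Lemma phase_small (c : R) x : 0 < c -> c / (2 * decay al) <= x -> 
  c * e x <= 1.
Proof.
move=> c0; have k0 := decay_gt0 al_pi al0; rewrite ler_pdivrMr ?mulr_gt0 // => cx.
rewrite /e; have -> : - 2 * (decay al * x) = - (x * (2 * decay al)) by ring.
rewrite expRN ler_pdivrMr ?expR_gt0 // mul1r.
by have := expR_ge1Dx (x * (2 * decay al)); lra.
Qed.

(** The upper bound C |w| exp (- 2 (k+1) Re w) beats exp (- 2 (k + 1/2) Re w) by
    the factor |w| exp (- Re w), up to a constant. *)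
Lemma diff_littleo k : (forall j, (j <= k)%N -> s j = st j) ->
  forall eps, 0 < eps -> exists A : R, forall r, A < r ->
    d r <= eps * expR (- 2 * (k%:R + 1 / 2) * Re (sqrtc (- ray al r))).
Proof.
move=> sst eps eps0; have k0 := decay_gt0 al_pi al0.
pose C : R := 16 * M%:R * (M%:R ^+ 2) ^+ k.
have C0 : 0 <= C by rewrite !mulr_ge0 // ?exprn_ge0 // exprn_ge0.
have B0 : 0 <= 4 * C / (decay al ^+ 2 * eps).
  apply: divr_ge0; first exact: mulr_ge0.
  by apply: mulr_ge0; [exact: sqr_ge0|exact: ltW].
(* The first summand serves [linear_le_expR], the second one gives e x <= 1/2. *)
pose X : R := 4 * C / (decay al ^+ 2 * eps) + (decay al)^-1.
have X0 : 0 < X.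
  by rewrite ltr_wpDl ?invr_gt0.
exists (X ^+ 2) => r Xr.
have r0 : 0 < r by apply: le_lt_trans Xr; exact: sqr_ge0.
have x0 : 0 < Num.sqrt r by rewrite sqrtr_gt0.
have Xx : X < Num.sqrt r.
  by rewrite -(ltr_pXn2r (ltn0Sn 1)) ?nnegrE ?sqrtr_ge0 ?ltW // sqr_sqrtr // ltW.
have [rho [rhot [h1 h2 h3 h4]]] := ray_reflections r0.
have := m_diff_upper sM stM h1 h2 h3 h4 sst.
rewrite normc_phase_ray // normc_sqrtc_ray ?(ltW r0) // -/C -/(d r) Re_sqrtc_ray ?(ltW r0) //.
move: x0 Xx; set x := Num.sqrt r => x0 Xx up.
have ex : e x <= 2^-1.
  suff : 2 * e x <= 1 by lra.
  apply: phase_small => //; apply: (le_trans _ (ltW Xx)); rewrite /X.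
  have -> : 2 / (2 * decay al) = (decay al)^-1 by field; rewrite gt_eqF.
  by rewrite lerDr.
apply: (le_trans (up ex)).
have eE : e x ^+ k.+1 =
    expR (- 2 * (k%:R + 1 / 2) * (decay al * x)) * expR (- (decay al * x)).
  by rewrite /e -expRM_natr -expRD -natr1; congr expR; field.
rewrite eE.
have lin : C * x <= eps * expR (decay al * x).
  apply: linear_le_expR => //; apply: (le_trans _ (ltW Xx)).
  by rewrite /X lerDl invr_ge0 ltW.
have P0 := expR_gt0 (decay al * x).
rewrite expRN; move: (expR (- 2 * _ * _)) (expR_ge0 (- 2 * (k%:R + 1 / 2) * (decay al * x))) => Q Q0.
have -> : C * (x * (Q / expR (decay al * x))) = (C * x / expR (decay al * x)) * Q by ring.
by rewrite ler_wpM2r // ler_pdivrMr.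
Qed.

(** Divided by |E|^j, the lower bound would keep |w| bounded along the ray. *)
Lemma diff_not_littleo k j : (j <= k)%N -> (forall i, (i < j)%N -> s i = st i) ->
  s j != st j ->
  ~ exists A : R, forall r, A < r ->
    d r <= expR (- 2 * (k%:R + 1 / 2) * Re (sqrtc (- ray al r))).
Proof.
move=> jk sst sj [A dA]; have k0 := decay_gt0 al_pi al0.
pose c : R := 16 * M%:R ^+ 3.
pose K : R := 8 * (M%:R ^+ 2) ^+ j.
have M1 : 1 <= M%:R :> R by have /andP[a b] := sM 0; rewrite ler1n (leq_trans a).
have c0 : 0 < c by rewrite mulr_gt0 // exprn_gt0 // (lt_le_trans ltr01).
have K0 : 0 <= K by rewrite mulr_ge0 // exprn_ge0 // exprn_ge0.
pose X := `|A| + K + c / (2 * decay al) + 1.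
have q0 : 0 <= c / (2 * decay al) by rewrite divr_ge0 // ?mulr_ge0 // ltW.
have A0 := normr_ge0 A.
have X1 : 1 <= X by rewrite /X; lra.
have r0 : 0 < X ^+ 2 by rewrite exprn_gt0 //; lra.
(* X exceeds K, and z of modulus X^2 gives |w| = X, against the bound |w| <= K. *)
have AX : A < X ^+ 2.
  have := ler_norm A; have : X <= X ^+ 2 by rewrite expr2 ler_peMl //; lra.
  rewrite {1}/X; lra.
have [rho [rhot [h1 h2 h3 h4]]] := ray_reflections r0.
have := m_diff_lower sM stM h1 h2 h3 h4 sst sj.
have := dA _ AX.
rewrite normc_phase_ray // normc_sqrtc_ray ?(ltW r0) // -/K -/(d _) Re_sqrtc_ray ?(ltW r0) //.
rewrite sqrtr_sqr ger0_norm ?(le_trans ler01) // => dX low.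
have {}low : e X ^+ j * X <= K * d (X ^+ 2).
  by apply: low; apply: phase_small => //; rewrite -/c /X; lra.
have eE : expR (- 2 * (k%:R + 1 / 2) * (decay al * X)) <= e X ^+ j.
  rewrite /e -expRM_natr ler_expR.
  have kj : j%:R <= k%:R :> R by rewrite ler_nat.
  have dX0 : 0 <= decay al * X by rewrite mulr_ge0 ?(ltW k0) // (le_trans ler01).
  have := ler_wpM2r dX0 kj; lra.
have ej0 : 0 < e X ^+ j by rewrite exprn_gt0 // expR_gt0.
have : e X ^+ j * X <= e X ^+ j * K.
  apply: (le_trans low); rewrite mulrC; apply: ler_wpM2r => //.
  exact: le_trans dX eE.
by rewrite ler_pM2l // /X; lra.
Qed.

End Pair.
End Asymptotics.

(* [sqrtc] is the principal branch: Re >= 0, and positive imaginary part on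
   the negative axis. *)
Theorem theorem3p5 (R : realType) (J : {fset nat})
    (J_pos : forall j : nat, j \in J -> (0 < j)%N)
    (J_card : (2 <= #|` J|)%N)
    (s st : nat -> nat)
    (sJ : forall n : nat, s n \in J) (stJ : forall n : nat, st n \in J)
    (m mt : R[i] -> R[i])
    (hm : is_weyl_titchmarsh s m) (hmt : is_weyl_titchmarsh st mt)
    (k : nat) :
  (forall j : nat, (j <= k)%N -> s j = st j) <->
  (forall alpha : R, - pi < alpha < pi -> alpha != 0 ->
     (fun r : R =>
        Normc.normc (m (ray alpha r) - mt (ray alpha r)) : R^o)
       =o_ (pinfty_nbhs R)
     (fun r : R =>
        expR (- 2 * (k%:R + 1 / 2) *
              complex.Re (sqrtc (- ray alpha r))) : R^o)).
Proof.
pose M := (\max_(j <- enum_fset J) j)%N.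
have JM j : j \in J -> (0 < j <= M)%N.
  by move=> jJ; rewrite J_pos //= /M; exact: (@leq_bigmax_seq _ _ xpredT (fun j => j) j).
have sM n : (0 < s n <= M)%N by exact: JM.
have stM n : (0 < st n <= M)%N by exact: JM.
split=> [sst al al_pi al0|lo].
  apply/eqoP => eps eps0.
  have [A HA] := diff_littleo sM stM hm hmt al_pi al0 sst eps0.
  exists A; split; first exact: num_real.
  move=> r Ar; rewrite ger0_norm ?normc_ge0 // ger0_norm ?expR_ge0 //; exact: HA.
move=> j0 j0k; apply/eqP; apply/negPn/negP => sj0.
have ex : exists j, s j != st j by exists j0.
case: (ex_minnP ex) => j sj jmin.
have jk : (j <= k)%N by apply: leq_trans j0k; exact: jmin.
have sst i : (i < j)%N -> s i = st i.
  by move=> ij; apply/eqP; apply: contraTT ij => /jmin; rewrite -leqNgt.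
(* One ray suffices for this direction. *)
have pi0 := @pi_gt0 R.
have al_pi : - pi < (pi / 2 : R) < pi by apply/andP; split; lra.
have al0 : pi / 2 != 0 :> R by rewrite gt_eqF // divr_gt0.
apply: (diff_not_littleo sM stM hm hmt al_pi al0 jk sst sj).
have /eqoP /(_ 1 ltr01) [A [_ HA]] := lo _ al_pi al0.
exists A => r /HA /=.
by rewrite mul1r ger0_norm ?normc_ge0 // ger0_norm ?expR_ge0.
Qed.
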